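(* Let $p$ be a probability density on $\mathbb{R}^n$ (the data distribution) with $p\in\mathcal{C}^2$ and $\mathbb{E}_{x\sim p}[\|x\|_2^2]<\infty$. Let $\gamma:[0,1]\to(0,\infty)$ be continuous, $\alpha_t:=e^{-\int_0^t\gamma(s)\,ds}$, $t\in(0,1]$, and $\sigma_t^2:=\frac{1-\alpha_t}{\alpha_t}$. Let $f$ be a classifier on $\mathbb{R}^n$ (a function from $\mathbb{R}^n$ to a finite set of labels), let $x_0\in\mathbb{R}^n$ be a sample, whose label $f(x_0)$ is the ground-truth label, and let $\mathcal{P}(\cdot\,;t):\mathbb{R}^n\to\mathbb{R}^n$ be the highest-density purification model of the reverse diffusion process, as defined in the context. For $y\in\mathbb{R}^n$ define $$\mathcal{D}_{\mathrm{sub}}(y;t):=\bigcap_{\{x'_0:\,f(x'_0)\neq f(y)\}}\left\{x_a\in\mathbb{R}^n:\ (x_a-y)^\top(x'_0-y)<\sigma_t^2\log\left(\frac{p(y)}{p(x'_0)}\right)+\frac{\|x'_0-y\|_2^2}{2}\right\}.$$ Let $x_a\in\mathbb{R}^n$ be the adversarial sample. Then: (i) the set $\mathcal{D}_{\mathrm{sub}}(x_0;t)$ is convex, and if $x_a\in\mathcal{D}_{\mathrm{sub}}(x_0;t)$ then the purified sample $\mathcal{P}(x_a;t)$ has the ground-truth label, i.e. $f(\mathcal{P}(x_a;t))=f(x_0)$; (ii) $f(\mathcal{P}(x_a;t))=f(x_0)$ if and only if $$x_a\in\mathcal{D}(\mathcal{G}(x_0);t):=\bigcup_{\tilde{x}_0:\,f(\tilde{x}_0)=f(x_0)}\mathcal{D}_{\mathrm{sub}}(\tilde{x}_0;t).$$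 In other words, $\mathcal{D}(\mathcal{G}(x_0);t)$ is the robust region of the data region $\mathcal{G}(x_0)=\{x: f(x)=f(x_0)\}$ under $\mathcal{P}(\cdot\,;t)$ and $f$.
   Context: Forward process: $d\mathbf{x}=h(\mathbf{x},t)\,dt+g(t)\,dw$, $\mathbf{x}_0\sim p$, with $h(x,t)=-\tfrac12\gamma(t)x$, $g(t)=\sqrt{\gamma(t)}$ and $w$ a standard Wiener process in $\mathbb{R}^n$. Thus $\mathbf{x}_t=\sqrt{\alpha_t}(\mathbf{x}_0+\boldsymbol{\epsilon}_t)$ with $\boldsymbol{\epsilon}_t\sim\mathcal{N}(0,\sigma_t^2I)$ independent of $\mathbf{x}_0$. Write $p_t$ for the density of $\mathbf{x}_t$. Reverse process: $\{\hat{\mathbf{x}}_t\}_{t\in[0,1]}$ solves the reverse-time SDE $d\hat{\mathbf{x}}=[h(\hat{\mathbf{x}},t)-g(t)^2\nabla_{\hat{\mathbf{x}}}\log p_t(\hat{\mathbf{x}})]\,dt+g(t)\,d\overline{w}$ ($\overline{w}$ a reverse-time standard Wiener process). It is a standing fact/convention that it exists and has the same distribution as $\{\mathbf{x}_t\}_{t\in[0,1]}$. The regularity conditions assumed are: $p\in\mathcal{C}^2$ with finite second moment; $h(\cdot,t)\in\mathcal{C}^1$ for all $t$, with $\|h(x,t)\|_2\le C(1+\|x\|_2)$ and $\|h(x,t)-h(y,t)\|_2\le C\|x-y\|_2$ for some $C>0$ and all $x,y,t$; $g$ continuous with $|g(t)|>0$ for all $t$. Conditional density: $\mathbb{P}(\hat{\mathbf{x}}_0=x\mid\hat{\mathbf{x}}_t=y)$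 denotes the conditional density of $\hat{\mathbf{x}}_0$ at $x$ given $\hat{\mathbf{x}}_t=y$, i.e. the (continuous version of the) joint density of $(\hat{\mathbf{x}}_0,\hat{\mathbf{x}}_t)$ at $(x,y)$ divided by the density of $\hat{\mathbf{x}}_t$ at $y$. Purification model: for $x_a\in\mathbb{R}^n$ set $x_{a,t}:=\sqrt{\alpha_t}\,x_a$ and $$\mathcal{P}(x_a;t):=\operatorname*{arg\,max}_{x\in\mathbb{R}^n}\ \mathbb{P}\left(\hat{\mathbf{x}}_0=x\mid\hat{\mathbf{x}}_t=x_{a,t}\right).$$ It is assumed that $\mathcal{P}(\cdot\,;t)$ is a well-defined deterministic map, i.e. for each $x_a$ the maximizer exists and is unique. Robust region: the robust region of $\mathcal{G}(x_0):=\{x: f(x)=f(x_0)\}$ under $\mathcal{P}(\cdot\,;t)$ and $f$ is the set $\{x\in\mathbb{R}^n: f(\mathcal{P}(x;t))=f(x_0)\}$. Convention for vanishing densities: $\log(a/0)=+\infty$ for $a>0$ and $\log(0/b)=-\infty$ for $b\ge 0$, so the corresponding set in the intersection is all of $\mathbb{R}^n$, respectively empty. *)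

(* Defs.v *)
From HB Require Import structures.
From mathcomp Require Import all_boot all_order all_algebra.
From mathcomp Require Import all_classical all_reals all_analysis.
Set Implicit Arguments.
Unset Strict Implicit.
Unset Printing Implicit Defensive.
Import Order.TTheory GRing.Theory Num.Theory.
Import numFieldNormedType.Exports.

Local Open Scope classical_set_scope.
Local Open Scope ring_scope.

(* 'rV[R]_n carries the product of the Borel sigma-algebras of its coordinates,
   as n.-tuple does in the library. *)
Definition rV_display : measure_display.
Proof. exact: default_measure_display. Qed.

Section measurable_rV.
Context {R : realType} (n : nat).

Let coords : 'I_n -> 'rV[R]_n -> measurableTypeR R := fun i x => x 0 i.

Let rV_set0 : g_sigma_preimage coords set0.
Proof. exact: sigma_algebra0. Qed.

Let rV_setC A : g_sigma_preimage coords A -> g_sigma_preimage coords (~` A).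
Proof. exact: sigma_algebraC. Qed.

Let rV_bigcup (F : _^nat) : (forall i, g_sigma_preimage coords (F i)) ->
  g_sigma_preimage coords (\bigcup_i (F i)).
Proof. exact: sigma_algebra_bigcup. Qed.

HB.instance Definition _ := @isMeasurable.Build rV_display
  'rV[R]_n (g_sigma_preimage coords) rV_set0 rV_setC rV_bigcup.

Lemma measurable_coord_rV (i : 'I_n) :
  measurable_fun [set: 'rV[R]_n] (fun x => x 0 i : measurableTypeR R).
Proof.
move=> _ Y mY; rewrite setTI; apply: sub_sigma_algebra => /=.
rewrite -bigcup_seq/=; exists i => /=; first by rewrite mem_index_enum.
by exists Y => //; rewrite setTI.
Qed.

Lemma measurable_fun_rV d (T : measurableType d) (f : T -> 'rV[R]_n) :
  (forall i, measurable_fun [set: T] (fun w => f w 0 i : measurableTypeR R)) ->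
  measurable_fun [set: T] f.
Proof.
move=> mf _ Y mY; rewrite setTI; move: Y mY.
apply: smallest_sub.
  split => [|A mA|F mF] /=.
  - by rewrite preimage_set0.
  - by rewrite setTD preimage_setC; exact: measurableC.
  - by rewrite preimage_bigcup; exact: bigcup_measurable.
rewrite -bigcup_seq; apply: bigcup_sub => i _ _ [A mA <-] /=.
by rewrite setTI; have := mf i measurableT A mA; rewrite setTI.
Qed.

End measurable_rV.

Section lebesgue_rV.
Context {R : realType} (n : nat).

Definition rV_cons (u : measurableTypeR R * 'rV[R]_n) : 'rV[R]_n.+1 :=
  \row_i (if unlift ord0 i is Some j then u.2 0 j else u.1).

Definition rV_uncons (x : 'rV[R]_n.+1) : measurableTypeR R * 'rV[R]_n :=
  (x 0 ord0, \row_j x 0 (lift ord0 j)).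

Lemma rV_consK : cancel rV_cons rV_uncons.
Proof.
case=> a v; congr pair; first by rewrite mxE unlift_none.
by apply/rowP => j; rewrite !mxE liftK.
Qed.

Lemma measurable_rV_cons : measurable_fun setT rV_cons.
Proof.
apply: measurable_fun_rV => i; under eq_fun do rewrite mxE.
case: (unliftP ord0 i) => [j|] _ //.
  exact: (measurableT_comp (measurable_coord_rV j) measurable_snd).
exact: measurable_fst.
Qed.

Lemma measurable_rV_uncons : measurable_fun setT rV_uncons.
Proof.
apply/measurable_fun_pairP; split; first exact: measurable_coord_rV.
apply: measurable_fun_rV => i /=.
by under eq_fun do rewrite mxE; exact: measurable_coord_rV.
Qed.

Variable mu : {sigma_finite_measure set 'rV[R]_n -> \bar R}.

Definition lebesgue_rVS : set 'rV[R]_n.+1 -> \bar R :=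
  pushforward (@lebesgue_measure R \x mu)%E rV_cons.

Let lebesgue_rVS0 : (lebesgue_rVS set0 = 0)%E.
Proof. by rewrite /lebesgue_rVS /pushforward preimage_set0 measure0. Qed.

Let lebesgue_rVS_ge0 A : (0 <= lebesgue_rVS A)%E.
Proof. by rewrite /lebesgue_rVS /pushforward; exact: measure_ge0. Qed.

Let lebesgue_rVS_sigma_additive : semi_sigma_additive lebesgue_rVS.
Proof.
move=> F mF tF mUF; rewrite /lebesgue_rVS /pushforward preimage_bigcup.
have mpre A : measurable A -> measurable (rV_cons @^-1` A).
  by move=> mA; rewrite -[X in measurable X]setTI; exact: measurable_rV_cons.
apply: measure_semi_sigma_additive.
- by move=> k; exact: mpre.
- apply/trivIsetP => /= i j _ _ ij; rewrite -preimage_setI.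
  by move/trivIsetP : tF => /(_ _ _ _ _ ij) ->//; rewrite preimage_set0.
- by rewrite -preimage_bigcup; exact: mpre.
Qed.

HB.instance Definition _ := isMeasure.Build _ _ _ lebesgue_rVS
  lebesgue_rVS0 lebesgue_rVS_ge0 lebesgue_rVS_sigma_additive.

Let lebesgue_rVS_sigma_finite : sigma_finite setT lebesgue_rVS.
Proof.
have /sigma_finiteP[F [TF ndF Foo]] := sigma_finiteT (@lebesgue_measure R).
have /sigma_finiteP[G [TG ndG Goo]] := sigma_finiteT mu.
exists (fun k => rV_uncons @^-1` (F k `*` G k)).
  apply/seteqP; split => // x _.
  have [k _ Fk] : (\bigcup_i F i) (rV_uncons x).1 by rewrite -TF.
  have [l _ Gl] : (\bigcup_i G i) (rV_uncons x).2 by rewrite -TG.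
  exists (maxn k l) => //; split.
  - by move: Fk; exact/subsetPset/ndF/leq_maxl.
  - by move: Gl; exact/subsetPset/ndG/leq_maxr.
move=> k; have [mF Fk] := Foo k; have [mG Gk] := Goo k; split.
  rewrite -[X in measurable X]setTI; apply: measurable_rV_uncons => //.
  exact: measurableX.
rewrite /lebesgue_rVS /pushforward -comp_preimage.
rewrite (_ : rV_uncons \o rV_cons = id); last first.
  by apply/funext => u; exact: rV_consK.
by rewrite preimage_id product_measure1E// lte_mul_pinfty// ge0_fin_numE.
Qed.

HB.instance Definition _ := Measure_isSigmaFinite.Build _ _ _ lebesgue_rVS
  lebesgue_rVS_sigma_finite.

End lebesgue_rV.

(* Lebesgue measure on R^n, by R^0 = {0} and R^(n+1) = R x R^n. *)
Fixpoint lebesgue_rV (R : realType) (n : nat) :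
    {sigma_finite_measure set 'rV[R]_n -> \bar R} :=
  match n with
  | 0 => @dirac _ 'rV[R]_0 0 R
  | m.+1 => lebesgue_rVS (lebesgue_rV R m)
  end.

Section euclidean.
Context {R : realType} {n : nat}.
Implicit Types (f : 'rV[R]_n -> R) (x y : 'rV[R]_n).

(* The library norm on 'rV is the sup norm. *)
Definition dot x y : R := \sum_(i < n) x 0 i * y 0 i.
Definition sqnorm x : R := dot x x.

Definition partial f (i : 'I_n) x : R := 'D_(delta_mx 0 i) f x.

Definition grad f x : 'rV[R]_n := \row_i partial f i x.

Definition C1 f :=
  continuous f /\
  forall i, (forall x, derivable f x (delta_mx 0 i)) /\ continuous (partial f i).

Definition C2 f := C1 f /\ forall i, C1 (partial f i).

Definition unique_argmax f x :=
  (forall y, f y <= f x) /\ (forall z, (forall y, f y <= f z) -> z = x).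

(* Density of N(0, v I). *)
Definition gaussian_pdf (v : R) x : R :=
  \prod_(i < n) normal_pdf 0 (Num.sqrt v) (x 0 i).

End euclidean.

Section random_variables.
Context {d : measure_display} {Om : measurableType d} {R : realType}.
Variable P : probability Om R.

Definition has_density {d'} {T : measurableType d'} (mu : set T -> \bar R)
    (X : Om -> T) (f : T -> R) :=
  [/\ measurable_fun setT f, forall x, 0 <= f x &
      forall A, measurable A -> P (X @^-1` A) = (\int[mu]_(x in A) (f x)%:E)%E].

(* [c x y] is the conditional density of [U] at [x] given [V = y], through the
   (unique) continuous versions of the densities. *)
Definition conditional_density {n : nat} (U V : Om -> 'rV[R]_n)
    (c : 'rV[R]_n -> 'rV[R]_n -> R) :=
  exists (j : 'rV[R]_n * 'rV[R]_n -> R) (q : 'rV[R]_n -> R),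
    [/\ has_density (lebesgue_rV R n \x lebesgue_rV R n)%E
          (fun w => (U w, V w)) j /\ continuous j,
        has_density (lebesgue_rV R n) V q /\ continuous q &
        forall x y, c x y = j (x, y) / q y].

End random_variables.

(* Processes are indexed by R; only the times in [0, 1] are constrained. *)
Section processes.
Context {d : measure_display} {Om : measurableType d} {R : realType} {n : nat}.
Variable P : probability Om R.
Implicit Types (W X : R -> Om -> 'rV[R]_n).

Definition measurable_process X :=
  forall t, 0 <= t <= 1 -> measurable_fun setT (X t).

Definition continuous_paths X :=
  {ae P, forall w, {within `[0, 1], continuous (fun t => X t w)}}.

Definition independent_increments W :=
  forall (m : nat) (s : nat -> R) (A : nat -> set 'rV[R]_n),
    (forall k, 0 <= s k <= 1) -> {homo s : j k / (j <= k)%N >-> j <= k} ->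
    (forall k, measurable (A k)) ->
    P [set w | forall k, (k < m)%N -> A k (W (s k.+1) w - W (s k) w)] =
    (\prod_(k < m) P [set w | A k (W (s k.+1) w - W (s k) w)%R])%E.

(* Standard Wiener process on [0, 1]. *)
Definition wiener_process W :=
  [/\ measurable_process W,
      {ae P, forall w, W 0 w = 0},
      continuous_paths W,
      independent_increments W &
      forall s t, 0 <= s -> s < t -> t <= 1 ->
        has_density P (lebesgue_rV R n) (fun w => W t w - W s w)
          (gaussian_pdf (t - s))].

Definition independent_of_process (Z : Om -> 'rV[R]_n) W :=
  forall (m : nat) (s : 'I_m -> R) (A : 'I_m -> set 'rV[R]_n) (B : set 'rV[R]_n),
    (forall k, 0 <= s k <= 1) -> (forall k, measurable (A k)) -> measurable B ->
    P [set w | B (Z w) /\ forall k, A k (W (s k) w)] =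
    (P [set w | B (Z w)] * P [set w | forall k, A k (W (s k) w)])%E.

Definition riemann_sum (g : R -> R) W (a b : R) (m : nat) (w : Om) : 'rV[R]_n :=
  let s k := a + (b - a) * k%:R / m.+1%:R in
  \sum_(k < m.+1) g (s k) *: (W (s k.+1) w - W (s k) w).

(* [I] is the integral of [g] against [dW] over [a, b].  For a deterministic
   continuous [g] it is the limit in probability of the Riemann sums. *)
Definition stochastic_integral (g : R -> R) W (a b : R) (I : Om -> 'rV[R]_n) :=
  measurable_fun setT I /\
  forall e : R, 0 < e ->
    P [set w | e <= `|I w - riemann_sum g W a b m w|] @[m --> \oo] --> 0%E.

(* [X] solves dX = b(X, t) dt + g(t) dW on [0, 1], started independently of [W];
   the diffusion coefficient is deterministic. *)
Definition sde_solution (b : 'rV[R]_n -> R -> 'rV[R]_n) (g : R -> R) W X :=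
  [/\ wiener_process W,
      measurable_process X /\ continuous_paths X,
      independent_of_process (X 0) W,
      {ae P, forall w, forall i : 'I_n,
        lebesgue_measure.-integrable `[0, 1]
          (fun u => (b (X u w) u 0 i)%:E)} &
      forall s t, 0 <= s -> s <= t -> t <= 1 ->
        exists I, stochastic_integral g W s t I /\
          {ae P, forall w, X t w = X s w +
             \row_i (\int[lebesgue_measure]_(u in `[s, t]) b (X u w) u 0 i) +
             I w}].

(* A solution of dX = b(X, t) dt + g(t) dWbar run from time 1 down to time 0:
   with u = 1 - t, [u |-> Wbar (1 - u)] is a standard Wiener process and
   [u |-> X (1 - u)] solves dY = - b(Y, 1 - u) du + g(1 - u) dWbar_(1 - u). *)
Definition reverse_sde_solution (b : 'rV[R]_n -> R -> 'rV[R]_n) (g : R -> R)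
    Wbar X :=
  sde_solution (fun x u => - b x (1 - u)) (fun u => g (1 - u))
    (fun u => Wbar (1 - u)) (fun u => X (1 - u)).

End processes.

Definition same_distribution {R : realType} {n : nat}
    {d : measure_display} {Om : measurableType d} (P : probability Om R)
    {d' : measure_display} {Om' : measurableType d'} (P' : probability Om' R)
    (X : R -> Om -> 'rV[R]_n) (X' : R -> Om' -> 'rV[R]_n) :=
  forall (m : nat) (s : 'I_m -> R) (A : 'I_m -> set 'rV[R]_n),
    (forall k, 0 <= s k <= 1) -> (forall k, measurable (A k)) ->
    P [set w | forall k, A k (X (s k) w)] =
    P' [set w | forall k, A k (X' (s k) w)].

Section diffusion.
Context {R : realType} {n : nat}.
Variable gamma : R -> R.
Implicit Types (x y xa : 'rV[R]_n).

Definition alpha (t : R) : R :=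
  expR (- \int[lebesgue_measure]_(s in `[0, t]) gamma s).

Definition sigma2 (t : R) : R := (1 - alpha t) / alpha t.

Definition fwd_drift x (t : R) : 'rV[R]_n := - (gamma t / 2) *: x.

Definition fwd_diffusion (t : R) : R := Num.sqrt (gamma t).

Definition rev_drift (pt : R -> 'rV[R]_n -> R) x (t : R) : 'rV[R]_n :=
  fwd_drift x t - fwd_diffusion t ^+ 2 *: grad (fun z => ln (pt t z)) x.

(* [xhat] is the reverse process on the probability space [P]. *)
Definition purification {d : measure_display} {Om : measurableType d}
    (P : probability Om R) (xhat : R -> Om -> 'rV[R]_n) (t : R)
    (Pur : 'rV[R]_n -> 'rV[R]_n) :=
  exists c, conditional_density P (xhat 0) (xhat t) c /\
    forall xa, unique_argmax (fun x => c x (Num.sqrt (alpha t) *: xa)) (Pur xa).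

(* log(a / b) for a, b >= 0; log(0 / b) = -oo even when b = 0. *)
Definition log_ratio (a b : R) : \bar R :=
  if a == 0 then -oo%E else if b == 0 then +oo%E else (ln (a / b))%:E.

Variables (L : finType) (f : 'rV[R]_n -> L) (p : 'rV[R]_n -> R) (t : R).

Definition D_sub y : set 'rV[R]_n :=
  \bigcap_(x' in [set x' | f x' <> f y])
    [set xa | ((dot (xa - y) (x' - y))%:E <
               (sigma2 t)%:E * log_ratio (p y) (p x') +
               (sqnorm (x' - y) / 2)%:E)%E].

Definition data_region (x0 : 'rV[R]_n) : set 'rV[R]_n := [set x | f x = f x0].

Definition D_region (x0 : 'rV[R]_n) : set 'rV[R]_n :=
  \bigcup_(y in data_region x0) D_sub y.

Definition robust_region (Pur : 'rV[R]_n -> 'rV[R]_n) (x0 : 'rV[R]_n) :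
  set 'rV[R]_n := [set x | f (Pur x) = f x0].

End diffusion.

(* Main.v *)
Require Import Defs.
From HB Require Import structures.
From mathcomp Require Import all_boot all_order all_algebra.
From mathcomp Require Import all_classical all_reals all_analysis.
From mathcomp Require Import measurable_realfun ring lra.
Set Implicit Arguments.
Unset Strict Implicit.
Unset Printing Implicit Defensive.
Import Order.TTheory GRing.Theory Num.Theory.
Import numFieldNormedType.Exports.

Local Open Scope classical_set_scope.
Local Open Scope ring_scope.

(* With E = exp (1/2 int_0^t gamma), the noise N = E X_t - X_0 is the limit in
   probability of linear combinations of Wiener increments, whose variances tend
   to E^2 - 1 = sigma_t^2; these combinations are independent of X_0.  Hence the
   law of (X_0, N) on cubes is squeezed between product laws, and shrinking the
   cubes identifies the continuous joint density of (X_0, X_t) at (x, y) as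
   E^n p(x) phi(E y - x), where phi is the density of N(0, sigma_t^2 I).  At
   y = sqrt(alpha_t) x_a the purified sample is therefore the unique maximizer of
   p(x) exp (- |x_a - x|^2 / (2 sigma_t^2)), and the half-space attached to x' in
   D_sub(y) says exactly that this function is smaller at x' than at y. *)

(** * Lebesgue measure on row vectors *)

(** The stochastic integral is known only through Riemann sums converging in probability, and only
    for the integrand [fwd_diffusion gamma], whereas the noise is the integral of E_s g(s) against
    dW. Hence two nested discretisations: on an outer grid the integrating factor is frozen at left
    endpoints, with an error controlled along each continuous path; on each cell the integral is
    then replaced by an inner Riemann sum. The variance error is bounded uniformly in the inner
    grid, so that grid can be refined last. Independence is likewise given only for finitely many
    values of W, and is therefore used before any limit is taken. What survives the limit are
    inequalities between probabilities of slightly different cubes, which suffice because the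
    densities are continuous. The cubes around x are much smaller than those around y: the event
    that X_t is close to y then nearly becomes an event on N alone, with a cube about E times as
    wide, whence the factor E^n. *)

Definition pushforward_measure d d' (T : measurableType d)
    (T' : measurableType d') (R : realType) (m : {measure set T -> \bar R})
    (f : T -> T') (mf : measurable_fun setT f) : {measure set T' -> \bar R} :=
  measure_function_pushforward__canonical__measure_function_Measure m mf.

Section rV_measurability.
Context {R : realType} {n : nat}.
Implicit Types x c : 'rV[R]_n.

Lemma norm_rV_ltP x (e : R) : 0 < e ->
  reflect (forall i, `|x 0 i| < e) (`|x| < e).
Proof.
move=> e0; rewrite [`|x|]mx_normrE; apply: (iffP (bigmax_ltP _ _ _ _)) => /=.
  by move=> [_ h] i; exact: (h (0, i)).
by move=> h; split=> // -[i j] _ /=; rewrite ord1.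
Qed.

Lemma norm_rV_leP x (e : R) : 0 <= e ->
  reflect (forall i, `|x 0 i| <= e) (`|x| <= e).
Proof.
move=> e0; rewrite [`|x|]mx_normrE; apply: (iffP (bigmax_leP _ _ _ _)) => /=.
  by move=> [_ h] i; exact: (h (0, i)).
by move=> h; split=> // -[i j] _ /=; rewrite ord1.
Qed.

(** For the sup norm a closed ball is a product of intervals, so its measurability and its Lebesgue
    measure are computed coordinate by coordinate. *)
Definition cube c (r : R) : set 'rV[R]_n := [set z | `|z - c| <= r].

Lemma cubeE c r : 0 <= r ->
  cube c r = \bigcap_(i in [set: 'I_n])
    ((fun x => x 0 i) @^-1` `[c 0 i - r, c 0 i + r]).
Proof.
move=> r0; apply/seteqP; split=> z /=; rewrite /cube/=.
  move=> /(norm_rV_leP _ r0) h i _ /=; have := h i.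
  by rewrite !mxE ler_distl in_itv/=.
move=> h; apply/(norm_rV_leP _ r0) => i; have := h i I.
by rewrite /= !mxE ler_distl in_itv.
Qed.

Lemma measurable_cube c r : measurable (cube c r).
Proof.
have [r0|r0] := leP 0 r; last first.
  suff -> : cube c r = set0 by exact: measurable0.
  by apply/seteqP; split=> // z /=; rewrite /cube/= leNgt (lt_le_trans r0).
rewrite cubeE//; apply: fin_bigcap_measurable => // i _.
rewrite -[X in measurable X]setTI; apply: measurable_coord_rV => //.
Qed.

Context {d : measure_display} {T : measurableType d}.
Implicit Types f g : T -> 'rV[R]_n.

Lemma measurable_rV_coord f (i : 'I_n) : measurable_fun setT f ->
  measurable_fun setT (fun w => f w 0 i : measurableTypeR R).
Proof. by move=> mf; exact: (measurableT_comp (measurable_coord_rV i) mf). Qed.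

Lemma measurable_rVD f g : measurable_fun setT f -> measurable_fun setT g ->
  measurable_fun setT (fun w => f w + g w).
Proof.
move=> mf mg; apply: measurable_fun_rV => i; under eq_fun do rewrite mxE.
by apply: measurable_funD; exact: measurable_rV_coord.
Qed.

Lemma measurable_rVZ f (k : R) : measurable_fun setT f ->
  measurable_fun setT (fun w => k *: f w).
Proof.
move=> mf; apply: measurable_fun_rV => i; under eq_fun do rewrite mxE.
by apply: measurable_funM => //; exact: measurable_rV_coord.
Qed.

Lemma measurable_rVB f g : measurable_fun setT f -> measurable_fun setT g ->
  measurable_fun setT (fun w => f w - g w).
Proof.
move=> mf mg; under eq_fun do rewrite -scaleN1r.
by apply: measurable_rVD => //; exact: measurable_rVZ.
Qed.

Lemma measurable_rV_sum (m : nat) (F : nat -> T -> 'rV[R]_n) :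
  (forall k, (k < m)%N -> measurable_fun setT (F k)) ->
  measurable_fun setT (fun w => \sum_(k < m) F k w).
Proof.
elim: m => [|m IH] mF.
  by under eq_fun do rewrite big_ord0; exact: measurable_cst.
under eq_fun do rewrite big_ord_recr/=.
by apply: measurable_rVD; [apply: IH => k km; exact/mF/ltnW|exact: mF].
Qed.

Lemma measurable_rV_norm_ge f (e : R) : measurable_fun setT f ->
  measurable [set w | e <= `|f w|].
Proof.
move=> mf; have [e0|e0] := ltP 0 e; last first.
  rewrite (_ : mkset _ = setT)//; apply/seteqP; split=> // w _ /=.
  exact: le_trans e0 (normr_ge0 _).
rewrite (_ : mkset _ =
    ~` (\bigcap_(i in [set: 'I_n]) ((fun w => f w 0 i) @^-1` `]- e, e[))).
  apply: measurableC; apply: fin_bigcap_measurable => // i _.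
  rewrite -[X in measurable X]setTI; apply: measurable_rV_coord => //.
apply/seteqP; split=> w /=.
  rewrite leNgt => /norm_rV_ltP h H; apply: h => // i.
  by have := H i I; rewrite /= in_itv/= ltr_norml.
rewrite leNgt => h; apply/negP => /norm_rV_ltP H; apply: h => i _ /=.
by rewrite in_itv/= -ltr_norml H.
Qed.

Lemma measurable_preimage_cube f c r : measurable_fun setT f ->
  measurable [set w | `|f w - c| <= r].
Proof.
move=> mf; rewrite (_ : mkset _ = f @^-1` (cube c r))//.
by rewrite -[X in measurable X]setTI; apply: mf => //; exact: measurable_cube.
Qed.

End rV_measurability.

Lemma measurable_rV_scale {R : realType} {n : nat} (k : R) :
  measurable_fun setT (fun x : 'rV[R]_n => k *: x).
Proof. exact: (@measurable_rVZ _ _ _ _ id). Qed.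

Section lebesgue_scaling.
Context {R : realType}.
Local Open Scope ereal_scope.
Notation mu := (@lebesgue_measure R).

(** The right-hand side is a measure in [A], so by uniqueness of Lebesgue measure only intervals ]a,
    b] need checking; their preimages are ]a / c, b / c]. *)
Lemma lebesgue_measure_scale (c : R) (A : set (measurableTypeR R)) :
  (0 < c)%R -> measurable A ->
  mu A = c%:E *
    pushforward mu (fun x : measurableTypeR R => c * x : measurableTypeR R)%R A.
Proof.
move=> c0 mA.
have mc : measurable_fun setT (fun x : measurableTypeR R => c * x : measurableTypeR R)%R.
  exact: measurable_funM.
pose P : {measure set (measurableTypeR R) -> \bar R} :=
  mscale (NngNum (ltW c0)) (pushforward_measure mu mc).
rewrite (@lebesgue_measure_unique R P)// => {A mA} X [[a b] _ <-].
rewrite /P/= /mscale/= /pushforward/=.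
have -> : ((fun x => c * x) @^-1` `]a, b]%classic = `]a / c, b / c]%classic :> set R)%R.
  apply/seteqP; split=> x /=; rewrite !in_itv/=.
    by rewrite ltr_pdivrMr// ler_pdivlMr// mulrC.
  by rewrite ltr_pdivrMr// ler_pdivlMr// mulrC.
rewrite !lebesgue_measure_itv/= !lte_fin ltr_pM2r ?invr_gt0//.
case: ifPn => // _; last by rewrite mule0.
by rewrite -!EFinD -EFinM -mulrBl mulrCA divff ?gt_eqF// mulr1.
Qed.

Lemma ge0_integral_lebesgue_scale (c : R) (f : measurableTypeR R -> \bar R) :
  (0 < c)%R -> measurable_fun setT f -> (forall x, 0 <= f x) ->
  \int[mu]_x f x = c%:E * \int[mu]_x f (c * x)%R.
Proof.
move=> c0 mf f0.
have mc : measurable_fun setT (fun x : measurableTypeR R => c * x : measurableTypeR R)%R.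
  exact: measurable_funM.
pose P : {measure set (measurableTypeR R) -> \bar R} :=
  mscale (NngNum (ltW c0)) (pushforward_measure mu mc).
rewrite (eq_measure_integral P); last first.
  move=> A mA _; exact: (lebesgue_measure_scale c0 mA).
rewrite /P ge0_integral_mscale//=.
by rewrite (ge0_integral_pushforward mc).
Qed.

Variable n : nat.

Lemma ge0_integral_rVS (mun : {sigma_finite_measure set 'rV[R]_n -> \bar R})
    (f : 'rV[R]_n.+1 -> \bar R) : measurable_fun setT f -> (forall x, 0 <= f x) ->
  \int[lebesgue_rVS mun]_x f x = \int[mu]_a \int[mun]_v f (rV_cons (a, v)).
Proof.
move=> mf f0; rewrite /lebesgue_rVS.
rewrite (@ge0_integral_pushforward _ _ _ _ _ (@rV_cons R n) (@measurable_rV_cons R n))//.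
rewrite preimage_setT fubini_tonelli1//=.
- by apply: measurableT_comp => //; exact: measurable_rV_cons.
Qed.

End lebesgue_scaling.

Lemma rV_consZ (R : realType) n (c a : R) (v : 'rV[R]_n) :
  c *: rV_cons (a, v) = rV_cons (c * a, c *: v).
Proof.
by apply/rowP => i; rewrite !mxE/=; case: unliftP => [j|] _ //; rewrite mxE.
Qed.

(** Induction on the dimension by Tonelli: each coordinate contributes one factor [c]. *)
Lemma ge0_integral_lebesgue_rV_scale (R : realType) n (c : R)
    (f : 'rV[R]_n -> \bar R) :
  0 < c -> measurable_fun setT f -> (forall x, (0 <= f x)%E) ->
  (\int[lebesgue_rV R n]_x f x =
   (c ^+ n)%:E * \int[lebesgue_rV R n]_x f (c *: x))%E.
Proof.
move=> c0; elim: n f => [|n IH] f mf f0.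
  rewrite expr0 mul1e; apply: eq_integral => x _; congr f.
  by apply/rowP; case.
rewrite /= !ge0_integral_rVS//; last exact: (measurableT_comp mf (measurable_rV_scale c)).
have m1 : measurable_fun setT (fun a : measurableTypeR R =>
    (\int[lebesgue_rV R n]_v f (rV_cons (a, v)))%E).
  apply: (@measurable_fun_fubini_tonelli_F _ _ _ _ _ (lebesgue_rV R n)
    (f \o @rV_cons R n)) => [|x]; last exact: f0.
  by apply: measurableT_comp => //; exact: measurable_rV_cons.
rewrite (ge0_integral_lebesgue_scale c0 m1)//; last first.
  by move=> x; apply: integral_ge0.
rewrite exprS EFinM -muleA; congr (_ * _)%E.
rewrite -ge0_integralZl//; last 3 first.
- apply: (@measurable_fun_fubini_tonelli_F _ _ _ _ _ (lebesgue_rV R n)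
    (f \o (fun x => c *: x) \o @rV_cons R n)) => [|x]; last exact: f0.
  apply: (@measurableT_comp _ _ _ _ _ _ (f \o (fun x => c *: x))); last first.
    exact: measurable_rV_cons.
  exact: (measurableT_comp mf (measurable_rV_scale c)).
- by move=> a _; apply: integral_ge0 => v _; exact: f0.
- by rewrite lee_fin exprn_ge0// ltW.
apply: eq_integral => a _; rewrite IH//.
- by congr (_ * _)%E; apply: eq_integral => v _; rewrite rV_consZ.
- apply: measurableT_comp => //.
  exact: (measurableT_comp (@measurable_rV_cons R n) (measurable_pair1 _)).
Qed.

Lemma lebesgue_rV_cube (R : realType) n (c : 'rV[R]_n) (r : R) : 0 <= r ->
  lebesgue_rV R n (cube c r) = ((r *+ 2) ^+ n)%:E.
Proof.
move=> r0; elim: n c => [|n IH] c.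
  rewrite expr0 /= diracE mem_set//= /cube/=; apply/norm_rV_leP => //; case => //.
pose A : set (measurableTypeR R) := `[c 0 ord0 - r, c 0 ord0 + r]%classic.
pose c' : 'rV[R]_n := \row_j c 0 (lift ord0 j).
rewrite /= /lebesgue_rVS /pushforward.
have -> : @rV_cons R n @^-1` cube c r = A `*` cube c' r.
  apply/seteqP; split=> -[a v]; rewrite /cube /A /=.
    move=> /(norm_rV_leP _ r0) h; split.
      by have := h ord0; rewrite !mxE unlift_none/= in_itv/= ler_distl.
    apply/norm_rV_leP => // j.
    by have := h (lift ord0 j); rewrite !mxE liftK.
  rewrite in_itv/= -ler_distl => -[h1 /(norm_rV_leP _ r0) h2].
  apply/norm_rV_leP => // i; rewrite !mxE/=.
  by case: unliftP => [j ->|->] //; have := h2 j; rewrite !mxE.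
rewrite product_measure1E; last 2 first.
- exact: measurable_itv.
- exact: measurable_cube.
transitivity ((r *+ 2)%:E * ((r *+ 2) ^+ n)%:E)%E; last by rewrite -EFinM -exprS.
congr (_ * _)%E; last exact: IH.
apply: etrans; first exact: lebesgue_measure_itv.
rewrite /= lte_fin; case: ifPn => [_|]; first by rewrite -EFinD; congr EFin; ring.
(* The other branch of the length formula: the interval is a single point. *)
rewrite -leNgt => h; have -> : r = 0 by lra.
by rewrite mul0rn.
Qed.

(** * Sums of random vectors *)

(** Rectangles are stable under intersection and generate the product sigma-algebra; since [m1] is
    finite, the whole space serves as exhausting sequence. *)
Lemma measure_unique_prod d1 d2 (T1 : measurableType d1) (T2 : measurableType d2)
    (R : realType) (m1 m2 : {measure set (T1 * T2) -> \bar R}) :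
  (m1 setT < +oo)%E ->
  (forall A B, measurable A -> measurable B -> m1 (A `*` B) = m2 (A `*` B)) ->
  forall C, measurable C -> m1 C = m2 C.
Proof.
move=> m1fin m12 C mC.
apply: (measure_unique [set A `*` B | A in measurable & B in measurable]
  (fun=> setT)) => //.
- exact: measurable_prod_measurableType.
- move=> _ _ [A1 mA1 [B1 mB1 <-]] [A2 mA2 [B2 mB2 <-]].
  by rewrite -setXI; exists (A1 `&` A2); [exact: measurableI|
    exists (B1 `&` B2) => //; exact: measurableI].
- by move=> _; exists setT => //; exists setT => //; rewrite setXTT.
- by rewrite bigcup_const//; exists 0%N.
- by move=> _ [A mA [B mB <-]]; exact: m12.
Qed.

Section law_of_sums.
Context {d1 d2 : measure_display} {T1 : measurableType d1}
  {T2 : measurableType d2} {R : realType} {n : nat}.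
Variables (mu : {measure set T1 -> \bar R}) (nu : {measure set T2 -> \bar R}).
Variables (U : nat -> T1 -> 'rV[R]_n) (V : nat -> T2 -> 'rV[R]_n).
Hypothesis mufin : (mu setT < +oo)%E.
Hypothesis mU : forall k, measurable_fun setT (U k).
Hypothesis mV : forall k, measurable_fun setT (V k).

(* The events [D] and [D'] are there for the induction: conditioning on the last
   vector turns a statement about m.+1 vectors into one about m vectors. *)
Lemma eq_measure_sum (m : nat) (D : set T1) (D' : set T2) :
  measurable D -> measurable D' ->
  (forall A : nat -> set 'rV[R]_n, (forall k, measurable (A k)) ->
    mu (D `&` [set w | forall k, (k < m)%N -> A k (U k w)]) =
    nu (D' `&` [set w | forall k, (k < m)%N -> A k (V k w)])) ->
  forall B, measurable B ->
  mu (D `&` [set w | B (\sum_(k < m) U k w)]) =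
  nu (D' `&` [set w | B (\sum_(k < m) V k w)]).
Proof.
elim: m D D' => [|m IH] D D' mD mD' DD' B mB.
  have [B0|B0] := pselect (B 0).
    have /= := DD' (fun=> setT) (fun=> measurableT).
    congr (mu _ = nu _); congr (_ `&` _); apply/seteqP; split=> w //= _;
      by rewrite big_ord0.
  rewrite (_ : D `&` _ = set0); last first.
    by apply/seteqP; split=> w // [_ /=]; rewrite big_ord0.
  rewrite (_ : D' `&` _ = set0) ?measure0//.
  by apply/seteqP; split=> w // [_ /=]; rewrite big_ord0.
have mpre d (T : measurableType d) (X : T -> 'rV[R]_n) (A : set 'rV[R]_n) :
    measurable_fun setT X -> measurable A -> measurable [set w | A (X w)].
  by move=> mX mA; rewrite -[X in measurable X]setTI; exact: mX.
have joint (A : set 'rV[R]_n) (C : set 'rV[R]_n) : measurable A -> measurable C ->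
    mu (D `&` [set w | (A `*` C) (\sum_(k < m) U k w, U m w)]) =
    nu (D' `&` [set w | (A `*` C) (\sum_(k < m) V k w, V m w)]).
  move=> mA mC.
  have EE d (T : measurableType d) (X : nat -> T -> 'rV[R]_n) F :
      F `&` [set w | (A `*` C) (\sum_(k < m) X k w, X m w)] =
      (F `&` [set w | C (X m w)]) `&` [set w | A (\sum_(k < m) X k w)].
    by rewrite -setIA; congr (_ `&` _); apply/seteqP; split=> w /= [].
  rewrite !EE; apply: IH => // [||E mE].
  - by apply: measurableI => //; exact: mpre.
  - by apply: measurableI => //; exact: mpre.
  (* The conditions on the first m vectors and the one on the last vector merge into one family of
     m.+1 conditions. *)
  - have E' d (T : measurableType d) (X : nat -> T -> 'rV[R]_n) F :
      (F `&` [set w | C (X m w)]) `&` [set w | forall k, (k < m)%N -> E k (X k w)]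
      = F `&` [set w | forall k, (k < m.+1)%N ->
                 (if (k < m)%N then E k else C) (X k w)].
      rewrite -setIA; congr (_ `&` _); apply/seteqP; split=> w /=.
        move=> [hC hE] k; case: (ltnP k m) => [km _|mk km]; first exact: hE.
        by rewrite (_ : k = m)//; apply/eqP; rewrite eqn_leq mk -ltnS km.
      move=> h; split; first by have := h m (ltnSn m); rewrite ltnn.
      by move=> k km; have := h k (ltnW km); rewrite km.
    rewrite !E'; apply: (DD' (fun k => if (k < m)%N then E k else C)) => k.
    by case: ifP.
have mS d (T : measurableType d) (X : nat -> T -> 'rV[R]_n) :
    (forall k, measurable_fun setT (X k)) ->
    measurable_fun setT (fun w => (\sum_(k < m) X k w, X m w)).
  move=> mX; apply/measurable_fun_pairP; split; last exact: mX.
  by apply: measurable_rV_sum => k _; exact: mX.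
have madd : measurable_fun setT (fun z : 'rV[R]_n * 'rV[R]_n => z.1 + z.2).
  by apply: measurable_rVD; [exact: measurable_fst|exact: measurable_snd].
(* The laws of (partial sum, last vector), restricted to [D] and [D'], agree on rectangles by
   [joint]; they are evaluated on the event that the two components add up to a point of [B]. *)
have := @measure_unique_prod _ _ _ _ _
  (pushforward_measure (mrestr mu mD) (mS _ _ _ mU))
  (pushforward_measure (mrestr nu mD') (mS _ _ _ mV)) _ _
  [set z | B (z.1 + z.2)].
rewrite /= /pushforward /mrestr /= !preimage_setT.
have -> d (T : measurableType d) (X : nat -> T -> 'rV[R]_n) E :
    (fun w => (\sum_(k < m) X k w, X m w)) @^-1` [set z | B (z.1 + z.2)] `&` E
    = E `&` [set w | B (\sum_(k < m.+1) X k w)].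
  by rewrite setIC; congr (_ `&` _); apply/seteqP; split=> w /=;
    rewrite big_ord_recr.
have -> d (T : measurableType d) (X : nat -> T -> 'rV[R]_n) E :
    (fun w => (\sum_(k < m) X k w, X m w)) @^-1` [set z | B (z.1 + z.2)] `&` E
    = E `&` [set w | B (\sum_(k < m.+1) X k w)].
  by rewrite setIC; congr (_ `&` _); apply/seteqP; split=> w /=;
    rewrite big_ord_recr.
apply.
- apply: le_lt_trans mufin; apply: le_measure; rewrite ?inE//.
  by rewrite setTI.
- move=> A C mA mC; rewrite [_ `&` D]setIC [_ `&` D']setIC; exact: joint.
- exact: mpre.
Qed.

End law_of_sums.

(** * Linear combinations of Wiener increments *)

Section gaussian_density.
Context {R : realType} {n : nat}.

Lemma measurable_gaussian_pdf (v : R) :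
  measurable_fun setT (gaussian_pdf v : 'rV[R]_n -> R).
Proof.
rewrite /gaussian_pdf; apply: measurable_prod => i _.
exact: (measurableT_comp (measurable_normal_pdf _ _) (measurable_coord_rV i)).
Qed.

Lemma gaussian_pdf_ge0 (v : R) (x : 'rV[R]_n) : 0 <= gaussian_pdf v x.
Proof. by apply: prodr_ge0 => i _; exact: normal_pdf_ge0. Qed.

Lemma gaussian_pdfE (v : R) (x : 'rV[R]_n) : 0 < v ->
  gaussian_pdf v x =
  normal_peak (Num.sqrt v) ^+ n * expR (- (sqnorm x / (v *+ 2))).
Proof.
move=> v0; have s0 : Num.sqrt v != 0 by rewrite gt_eqF// sqrtr_gt0.
rewrite /gaussian_pdf normal_pdfE// big_split/= prodr_const card_ord.
congr (_ * _); rewrite /normal_fun -expR_sum; congr expR.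
rewrite /sqnorm /dot mulr_suml -sumrN; apply: eq_bigr => i _.
by rewrite sqr_sqrtr ?ltW// subr0 mulNr expr2.
Qed.

Lemma sqnormZ (c : R) (x : 'rV[R]_n) : sqnorm (c *: x) = c ^+ 2 * sqnorm x.
Proof.
by rewrite /sqnorm /dot mulr_sumr; apply: eq_bigr => i _; rewrite !mxE; ring.
Qed.

(** The exponent is invariant, and the peak of each coordinate factor is divided by [c], which the
    Jacobian [c ^+ n] compensates. *)
Lemma gaussian_pdf_scale (c v : R) (x : 'rV[R]_n) : 0 < c -> 0 < v ->
  c ^+ n * gaussian_pdf (c ^+ 2 * v) (c *: x) = gaussian_pdf v x.
Proof.
move=> c0 v0; rewrite !gaussian_pdfE ?mulr_gt0 ?exprn_gt0//.
rewrite sqnormZ mulrA -exprMn; congr (_ ^+ _ * expR (- _)); last first.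
  by rewrite -mulrnAr -mulf_div divff ?mul1r// expf_eq0/= gt_eqF.
rewrite /normal_peak !sqr_sqrtr ?mulr_ge0 ?sqr_ge0// ?ltW//.
rewrite -!mulrnAr -mulrA (sqrtrM _ (sqr_ge0 c)) sqrtr_sqr ger0_norm ?ltW//.
by rewrite invfM mulrA divff ?mul1r// gt_eqF.
Qed.

Lemma continuous_sqnorm : continuous (sqnorm : 'rV[R]_n -> R).
Proof.
apply: continuous_big => [|i _]; first exact: add_continuous.
have ci := @coord_continuous R 1 n 0 i.
by move=> x; exact: (cvgM (ci x) (ci x)).
Qed.

Lemma continuous_gaussian_pdf (v : R) : 0 < v ->
  continuous (gaussian_pdf v : 'rV[R]_n -> R).
Proof.
move=> v0; have -> : gaussian_pdf v = (fun x : 'rV[R]_n =>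
    normal_peak (Num.sqrt v) ^+ n * expR (- (sqnorm x / (v *+ 2)))).
  by apply/funext => x; exact: gaussian_pdfE.
have cs : continuous (fun x : 'rV[R]_n => - (sqnorm x / (v *+ 2))).
  move=> x; have := @continuous_sqnorm x => cx.
  exact: (cvgN (cvgM cx (cvg_cst _))).
move=> x; have h := continuous_comp (cs x) (@continuous_expR R _).
exact: (cvgM (cvg_cst _) h).
Qed.

Context {d : measure_display} {Om : measurableType d} (P : probability Om R).

Lemma has_density_gaussian_scale (Z : Om -> 'rV[R]_n) (c v : R) :
  0 < c -> 0 < v -> has_density P (lebesgue_rV R n) Z (gaussian_pdf v) ->
  has_density P (lebesgue_rV R n) (fun w => c *: Z w) (gaussian_pdf (c ^+ 2 * v)).
Proof.
move=> c0 v0 [_ _ PZ]; split.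
- exact: measurable_gaussian_pdf.
- exact: gaussian_pdf_ge0.
move=> A mA.
have mcA : measurable ((fun x : 'rV[R]_n => c *: x) @^-1` A).
  rewrite -[X in measurable X]setTI.
  exact: (measurable_rV_scale c).
apply: (etrans (PZ _ mcA)).
have mg u : measurable_fun setT (fun x : 'rV[R]_n => (gaussian_pdf u x)%:E).
  by apply/measurable_EFinP; exact: measurable_gaussian_pdf.
have mgA u : measurable_fun setT
    ((fun x : 'rV[R]_n => (gaussian_pdf u x)%:E) \_ A).
  by apply: (measurable_restrictT _ mA).1; exact: (measurable_funTS (mg u)).
(* The scaling formula concerns integrals over the whole space, so both integrands are extended by
   0. *)
rewrite [RHS]integral_mkcond [LHS]integral_mkcond.
rewrite [RHS](ge0_integral_lebesgue_rV_scale c0); last 2 first.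
- exact: mgA.
- by move=> x; rewrite erestrict_ge0// => y _; rewrite lee_fin gaussian_pdf_ge0.
rewrite -ge0_integralZl//; last 3 first.
- exact: (measurableT_comp (mgA _) (measurable_rV_scale c)).
- by move=> x _; rewrite erestrict_ge0// => y _; rewrite lee_fin gaussian_pdf_ge0.
- by rewrite lee_fin exprn_ge0// ltW.
apply: eq_integral => x _; rewrite /patch.
rewrite (_ : (x \in _) = (c *: x \in A)); last by apply/idP/idP; rewrite !inE.
case: ifPn => _; last by rewrite mule0.
by rewrite -EFinM gaussian_pdf_scale.
Qed.

End gaussian_density.

Section wiener_sums.
Context {R : realType} {n : nat} {d : measure_display} {Om : measurableType d}.
Variables (P : probability Om R) (W : R -> Om -> 'rV[R]_n).

(** Independence is given for cylinder events of [W], and an event on a weighted sum is not of this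
    form. It says that [P] on the event Z in A and the rescaled measure P(Z in A) P agree on
    cylinders; [eq_measure_sum] transfers the agreement to sums. *)
Lemma independent_lincomb (Z : Om -> 'rV[R]_n) (m : nat) (r e : nat -> R)
    (A B : set 'rV[R]_n) :
  measurable_process W -> independent_of_process P Z W ->
  measurable_fun setT Z ->
  (forall k, 0 <= r k <= 1) -> measurable A -> measurable B ->
  P (Z @^-1` A `&` [set w | B (\sum_(k < m) e k *: W (r k) w)]) =
  (P (Z @^-1` A) * P [set w | B (\sum_(k < m) e k *: W (r k) w)%R])%E.
Proof.
move=> mW ZW mZ r01 mA mB.
have mZA : measurable (Z @^-1` A).
  by rewrite -[X in measurable X]setTI; exact: mZ.
have q0 : 0 <= fine (P (Z @^-1` A)) by rewrite fine_ge0.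
pose nu : {measure set Om -> \bar R} := mscale (NngNum q0) P.
have mU k : measurable_fun setT (fun w => e k *: W (r k) w).
  by apply: measurable_rVZ; exact: mW.
have := @eq_measure_sum _ _ _ _ _ _ P nu _ _ _ mU mU m (Z @^-1` A) setT.
move=> /(_ _ mZA measurableT); rewrite /nu/= /mscale/=.
move=> /(_ _ _ B mB); rewrite setTI fineK ?fin_num_measure//; apply.
  by rewrite probability_setT ltry.
move=> C mC; rewrite setTI.
have := ZW m (fun k => r k) (fun k => (fun x => e k *: x) @^-1` C k) A.
have E : [set w | forall k : 'I_m, ((fun x => e k *: x) @^-1` C k) (W (r k) w)] =
    [set w | forall k, (k < m)%N -> C k (e k *: W (r k) w)].
  apply/seteqP; split=> w /= h k; last exact: h.
  by move=> km; exact: (h (Ordinal km)).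
rewrite E => <-//; last first.
  move=> k; rewrite -[X in measurable X]setTI.
  exact: (measurable_rV_scale (e k)).
congr (P _); apply/seteqP; split=> w /= [Aw h]; split=> // k.
  by exact: h.
by move=> km; exact: (h (Ordinal km)).
Qed.

Hypothesis Ww : wiener_process P W.

Lemma wiener_increment_density (s t : R) : 0 <= s -> s < t -> t <= 1 ->
  has_density P (lebesgue_rV R n) (fun w => W t w - W s w) (gaussian_pdf (t - s)).
Proof. by case: Ww => _ _ _ _; exact. Qed.

Lemma measurable_wiener_increment (s t : R) : 0 <= s <= 1 -> 0 <= t <= 1 ->
  measurable_fun setT (fun w => W t w - W s w).
Proof. by case: Ww => mW _ _ _ _ s01 t01; apply: measurable_rVB; exact: mW. Qed.

(* A sum of independent Gaussian vectors is compared with a telescoping sum of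
   rescaled increments of [W] having the same variances, so that no convolution
   is needed. *)
Lemma wiener_lincomb_law (m : nat) (s c : nat -> R) (V : R)
    (B : set 'rV[R]_n) :
  (0 < m)%N -> (forall k, 0 <= s k <= 1) ->
  {homo s : j k / (j <= k)%N >-> j <= k} ->
  (forall k, (k < m)%N -> s k < s k.+1) -> (forall k, 0 < c k) ->
  V = \sum_(k < m) c k ^+ 2 * (s k.+1 - s k) -> measurable B ->
  P [set w | B (\sum_(k < m) c k *: (W (s k.+1) w - W (s k) w))] =
  P [set w | B (Num.sqrt V *: (W 1 w - W 0 w))].
Proof.
move=> m0 s01 shomo sS c0 VE mB.
have [mW _ _ Wind _] := Ww.
pose q k := c k ^+ 2 * (s k.+1 - s k).
have q0 k : (k < m)%N -> 0 < q k.
  by move=> km; rewrite mulr_gt0 ?exprn_gt0// subr_gt0 sS.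
have q0' k : 0 <= q k by rewrite mulr_ge0 ?sqr_ge0// subr_ge0 shomo.
(* Normalised cumulated variance: the increment of [W] over [T k, T k.+1], multiplied by sqrt V, has
   variance [q k]. The [minn] freezes [T] at 1 after m steps, since independence of increments is
   stated for sequences that are monotone and in [0, 1] at all indices. *)
pose T k := (\sum_(j < minn k m) q j) / V.
have V0 : 0 < V.
  rewrite VE; case: m m0 q0 {sS VE T} => // m _ q0.
  rewrite big_ord_recr/=; apply: ltr_wpDl; last exact: q0.
  by apply: sumr_ge0 => i _; exact: q0'.
have TS k : (k < m)%N -> T k.+1 - T k = q k / V.
  move=> km; rewrite /T -mulrBl (minn_idPl km) (minn_idPl (ltnW km)).
  by rewrite big_ord_recr/= addrAC subrr add0r.
have Thomo : {homo T : j k / (j <= k)%N >-> j <= k}.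
  move=> j k jk; rewrite /T ler_pM2r ?invr_gt0//.
  rewrite -!(big_mkord xpredT q) (@big_cat_nat _ _ _ (minn j m) 0%N (minn k m))//=.
    by rewrite lerDl sumr_ge0.
  by rewrite leq_min geq_minr andbT (leq_trans (geq_minl _ _)).
have T0 : T 0%N = 0 by rewrite /T min0n big_ord0 mul0r.
have Tm k : (m <= k)%N -> T k = 1.
  by move=> mk; rewrite /T (minn_idPr mk) -VE divff// gt_eqF.
have T01 k : 0 <= T k <= 1.
  rewrite -{1}T0 Thomo//=.
  by have [km|/ltnW mk] := leqP k m; [rewrite -(Tm m)// Thomo|rewrite Tm].
pose U k w := c k *: (W (s k.+1) w - W (s k) w).
pose U' k w := Num.sqrt V *: (W (T k.+1) w - W (T k) w).
have mU k : measurable_fun setT (U k).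
  by apply: measurable_rVZ; exact: measurable_wiener_increment.
have mU' k : measurable_fun setT (U' k).
  by apply: measurable_rVZ; exact: measurable_wiener_increment.
have telescope w : \sum_(k < m) U' k w = Num.sqrt V *: (W 1 w - W 0 w).
  rewrite /U' -scaler_sumr -(Tm m)// -T0; congr (_ *: _).
  by rewrite -(big_mkord xpredT (fun k => W (T k.+1) w - W (T k) w)) telescope_sumr.
under [in RHS]eq_set => w do rewrite -telescope.
have Pfin : (P setT < +oo)%E by rewrite probability_setT ltry.
have := @eq_measure_sum _ _ _ _ _ _ P P U U' Pfin mU mU' m setT setT.
move=> /(_ measurableT measurableT _ B mB); rewrite !setTI; apply.
move=> A mA; rewrite !setTI.
have mcA k (a : R) : measurable ((fun x : 'rV[R]_n => a *: x) @^-1` A k).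
  by rewrite -[X in measurable X]setTI; exact: (measurable_rV_scale a).
apply: (etrans (Wind m s (fun k => (fun x => c k *: x) @^-1` A k) s01 shomo
  (fun k => mcA k (c k)))); apply/esym.
apply: (etrans (Wind m T (fun k => (fun x => Num.sqrt V *: x) @^-1` A k) T01
  Thomo (fun k => mcA k (Num.sqrt V)))); apply/esym.
apply: eq_bigr => k _ /=.
have sV0 : 0 < Num.sqrt V by rewrite sqrtr_gt0.
have km := ltn_ord k.
have Tlt : T k < T k.+1 by rewrite -subr_gt0 TS// divr_gt0// q0.
have dens (u : nat -> R) : (forall i, 0 <= u i <= 1) -> u k < u k.+1 ->
    has_density P (lebesgue_rV R n) (fun w => W (u k.+1) w - W (u k) w)
      (gaussian_pdf (u k.+1 - u k)).
  move=> u01 ulu; apply: wiener_increment_density => //.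
    by case/andP: (u01 k).
  by case/andP: (u01 k.+1).
have sd : 0 < s k.+1 - s k by rewrite subr_gt0 sS.
have Td : 0 < T k.+1 - T k by rewrite subr_gt0.
have [_ _ hU] := has_density_gaussian_scale (c0 k) sd (dens s s01 (sS k km)).
have [_ _ hT] := has_density_gaussian_scale sV0 Td (dens T T01 Tlt).
have qE : Num.sqrt V ^+ 2 * (T k.+1 - T k) = c k ^+ 2 * (s k.+1 - s k).
  by rewrite TS// sqr_sqrtr ?ltW// mulrCA divff ?mulr1// gt_eqF.
rewrite qE in hT.
exact: (etrans (hU (A k) (mA k)) (esym (hT (A k) (mA k)))).
Qed.

End wiener_sums.

(** * Numerical integration of the drift *)

(** Heine's theorem from covering compactness: half of the continuity radius at a point serves both
    as radius of its neighbourhood and as bound on [th]. *)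
Lemma unif_continuous_itv (R : realType) (V : normedModType R) (phi : R -> V)
    (a b e : R) : 0 < e -> {within `[a, b], continuous phi} ->
  exists2 th, 0 < th & forall s u, a <= s <= b -> a <= u <= b ->
    `|s - u| < th -> `|phi s - phi u| < e.
Proof.
move=> e0 /subspace_continuousP cphi.
have /compact_near_coveringP := @segment_compact R a b.
pose P (th s : R) := s \in `[a, b] -> forall u, u \in `[a, b] ->
  `|s - u| < th -> `|phi s - phi u| < e.
move=> /(_ R (0^'+) P _) [].
  move=> x xab.
  have e2 : 0 < e / 2 by rewrite divr_gt0.
  have /cvgrPdist_lt /(_ _ e2) := cphi x xab.
  rewrite near_withinE /= => -[d /= d0 hd].
  exists (ball x (d / 2), [set th | th < d / 2]).
    split => /=; first by apply: nbhsx_ballx; rewrite divr_gt0.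
    by apply: nbhs_right_lt; rewrite divr_gt0.
  move=> [s th] /= [xs thd] sab u uab su.
  have ds : `|phi x - phi s| < e / 2.
    by apply: hd => //; apply: lt_trans xs _; rewrite gtr_pMr// invf_lt1// ltr1n.
  have du : `|phi x - phi u| < e / 2.
    apply: hd => //; rewrite /ball/=.
    apply: (le_lt_trans (ler_distD s x u)).
    by move: xs; rewrite /ball/= => xs; have := lt_trans su thd; lra.
  apply: (le_lt_trans (ler_distD (phi x) (phi s) (phi u))).
  by rewrite distrC; lra.
move=> th /= th0 hth; exists (th / 2); first by rewrite divr_gt0.
move=> s u sab uab su.
have := hth (th / 2); rewrite /ball/= sub0r normrN gtr0_norm ?divr_gt0//.
move=> /(_ _ _) h; apply: h => //.
by rewrite gtr_pMr// invf_lt1// ltr1n.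
Qed.

Section exponential_integrator.
Context {R : realType}.
Notation mu := (@lebesgue_measure R).
Implicit Types (phi X : R -> R) (a b s u e : R).

Lemma integrable_within_itv phi a b s u : {within `[a, b], continuous phi} ->
  a <= s -> u <= b -> mu.-integrable `[s, u] (EFin \o phi).
Proof.
move=> cphi as_ ub; apply: continuous_compact_integrable.
  exact: segment_compact.
apply: continuous_subspaceW cphi => z /=; rewrite !in_itv/= => /andP[sz zu].
by rewrite (le_trans as_ sz) (le_trans zu ub).
Qed.

Lemma RintegralB_itv phi a b s u : {within `[a, b], continuous phi} ->
  a <= s -> s <= u -> u <= b ->
  \int[mu]_(z in `[a, u]) phi z - \int[mu]_(z in `[a, s]) phi z =
  \int[mu]_(z in `[s, u]) phi z.
Proof.
move=> cphi as_ su ub.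
have iu := integrable_within_itv cphi (lexx a) ub.
rewrite Rintegral_itvB ?bnd_simp// Rintegral_itv_obnd_cbnd//.
apply: integrableS iu => // z /=; rewrite !in_itv/= => /andP[sz ->].
by rewrite (le_trans as_ (ltW sz)).
Qed.

Lemma Rintegral_itv_cst s u (k : R) : s <= u ->
  \int[mu]_(_ in `[s, u]) k = k * (u - s).
Proof.
move=> su; rewrite Rintegral_cst//; congr (_ * _).
apply: (etrans (congr1 fine (lebesgue_measure_itv _))).
rewrite /= lte_fin; case: ifPn => //=; rewrite -leNgt => us.
by apply/esym/eqP; rewrite subr_eq0 eq_le us su.
Qed.

Lemma Rintegral_itv_near_cst phi s u (c e : R) :
  mu.-integrable `[s, u] (EFin \o phi) -> s <= u ->
  (forall z, s <= z <= u -> `|phi z - c| <= e) ->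
  `|\int[mu]_(z in `[s, u]) phi z - c * (u - s)| <= e * (u - s).
Proof.
move=> iphi su phic.
have icst k : mu.-integrable `[s, u] (EFin \o (fun=> k)).
  apply: continuous_compact_integrable; first exact: segment_compact.
  by apply: continuous_subspaceT => z; exact: cvg_cst.
rewrite ler_norml -mulNr -!(Rintegral_itv_cst _ su) lerBrDl lerBlDl -!RintegralD//.
apply/andP; split; apply: le_Rintegral => //.
all: by move=> z; rewrite /= in_itv/= => /phic; rewrite ler_norml => /andP[]; lra.
Qed.

(** Equivalent to exp(-h) >= 1 - h. The second-order remainder is bounded by h times the increment
    exp h - 1, and not by h^2, so that errors on consecutive cells telescope. *)
Lemma expR_sub1_le (h : R) : expR h - 1 - h <= h * (expR h - 1).
Proof.
have h1 := expR_ge1Dx (- h).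
have h2 : 0 <= expR h * (expR (- h) - (1 - h)).
  by rewrite mulr_ge0 ?expR_ge0// subr_ge0.
by move: h2; rewrite mulrBr -expRD subrr expR0; lra.
Qed.

Variables (gamma : R -> R).
Hypothesis gamma_cont : {within `[0, 1], continuous gamma}.
Hypothesis gamma_gt0 : forall s, 0 <= s <= 1 -> 0 < gamma s.

Definition cumul s := \int[mu]_(z in `[0, s]) gamma z.

Lemma cumul_itv s u : 0 <= s -> s <= u -> u <= 1 ->
  cumul u - cumul s = \int[mu]_(z in `[s, u]) gamma z.
Proof. exact: RintegralB_itv. Qed.

Lemma cumul0 : cumul 0 = 0.
Proof. by rewrite /cumul set_itv1 Rintegral_set1. Qed.

Lemma cumul_le s u : 0 <= s -> s <= u -> u <= 1 -> cumul s <= cumul u.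
Proof.
move=> s0 su u1; rewrite -subr_ge0 cumul_itv//.
apply: Rintegral_ge0 => z; rewrite /= in_itv/= => /andP[sz zu].
by rewrite ltW// gamma_gt0// (le_trans s0 sz) (le_trans zu u1).
Qed.

Lemma gamma_bounded : exists2 G, 0 < G & forall s, 0 <= s <= 1 -> gamma s <= G.
Proof.
have /compact_bounded : compact (gamma @` `[0, 1]).
  by apply: continuous_compact => //; exact: segment_compact.
move=> [M [Mreal HM]]; exists (Num.max 1 (M + 1)).
  by rewrite lt_max ltr01.
move=> s s01; apply: (le_trans (ler_norm _)); rewrite le_max.
apply/orP; right; apply: HM; first by rewrite ltrDl.
by exists s => //=; rewrite in_itv.
Qed.

Lemma cumul_lip (G s u : R) : (forall z, 0 <= z <= 1 -> gamma z <= G) ->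
  0 <= s -> s <= u -> u <= 1 -> cumul u - cumul s <= G * (u - s).
Proof.
move=> hG s0 su u1; rewrite cumul_itv//.
have ig := integrable_within_itv gamma_cont s0 u1.
have : `|\int[mu]_(z in `[s, u]) gamma z - 0 * (u - s)| <= G * (u - s).
  apply: Rintegral_itv_near_cst => // z /andP[sz zu].
  have z01 : 0 <= z <= 1 by rewrite (le_trans s0 sz) (le_trans zu u1).
  by rewrite subr0 ger0_norm ?hG// ltW// gamma_gt0.
by rewrite mul0r subr0; apply: le_trans; exact: ler_norm.
Qed.

Lemma cumul_gt0 s : 0 < s -> s <= 1 -> 0 < cumul s.
Proof.
move=> s0 s1.
have cg : {within `[0, s], continuous gamma}.
  apply: continuous_subspaceW gamma_cont => z /=; rewrite !in_itv/=.
  by move=> /andP[-> /le_trans]; exact.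
have [c c0s hc] := EVT_min (ltW s0) cg.
have c01 : 0 <= c <= 1.
  by move: c0s; rewrite in_itv/= => /andP[-> /le_trans]; exact.
have gc := gamma_gt0 c01.
apply: (@lt_le_trans _ _ (gamma c * s)); first by rewrite mulr_gt0.
have -> : gamma c * s = \int[mu]_(_ in `[0, s]) gamma c.
  by rewrite Rintegral_itv_cst ?subr0 ?ltW.
apply: le_Rintegral => //.
- apply: continuous_compact_integrable; first exact: segment_compact.
  by apply: continuous_subspaceT => z; exact: cvg_cst.
- exact: (integrable_within_itv gamma_cont).
Qed.

(** The integrating factor of the linear drift, equal to 1 / sqrt(alpha_s). *)
Definition growth s := expR (cumul s / 2).

Lemma growth0 : growth 0 = 1.
Proof. by rewrite /growth cumul0 mul0r expR0. Qed.

Lemma growth_gt0 s : 0 < growth s. Proof. exact: expR_gt0. Qed.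

Lemma growth_le s u : 0 <= s -> s <= u -> u <= 1 -> growth s <= growth u.
Proof. by move=> *; rewrite ler_expR ler_pM2r ?invr_gt0// cumul_le. Qed.

(** With h half the increment of [cumul] and J the integral of the drift, the error is growth(s)
    times (exp h - 1 - h) X(u) + (J + h X(u)): a second-order remainder and the effect of freezing X
    at u in the drift. Both are at most a small factor times the increment of [growth]. *)
Lemma growth_step X (s u M om : R) : {within `[0, 1], continuous X} ->
  0 <= s -> s <= u -> u <= 1 -> `|X u| <= M ->
  (forall z, s <= z <= u -> `|X u - X z| <= om) ->
  `|growth u * X u - growth s * X s -
    growth s * (X u - (X s + \int[mu]_(z in `[s, u]) (- (gamma z / 2) * X z)))|
  <= (growth u - growth s) * ((cumul u - cumul s) / 2 * M + om).
Proof.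
move=> cX s0 su u1 XM Xom; set h := (cumul u - cumul s) / 2.
have h0 : 0 <= h by rewrite divr_ge0// subr_ge0 cumul_le.
have -> : growth u = growth s * expR h.
  by rewrite /growth -expRD; congr expR; rewrite /h; field.
have ig := integrable_within_itv gamma_cont s0 u1.
have cgX : {within `[0, 1], continuous (fun z => - (gamma z / 2) * X z)}.
  move=> z; apply: cvgM; last exact: cX.
  by apply: cvgN; apply: cvgM; [exact: gamma_cont|exact: cvg_cst].
have cg2 : {within `[0, 1], continuous (fun z => gamma z / 2)}.
  by move=> z; apply: cvgM; [exact: gamma_cont|exact: cvg_cst].
have igX := integrable_within_itv cgX s0 u1.
have ig2 := integrable_within_itv cg2 s0 u1.
have hE : h = \int[mu]_(z in `[s, u]) (gamma z / 2).
  by rewrite RintegralZr// /h cumul_itv.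
set J := \int[mu]_(z in _) (- _ * _).
have JE : `|J + h * X u| <= om * h.
  have -> : J + h * X u =
      \int[mu]_(z in `[s, u]) (- (gamma z / 2) * X z + gamma z / 2 * X u).
    rewrite RintegralD//; last first.
      have cg3 : {within `[0, 1], continuous (fun z => gamma z / 2 * X u)}.
        by move=> z; apply: cvgM; [exact: cg2|exact: cvg_cst].
      exact: (integrable_within_itv cg3 s0 u1).
    by rewrite RintegralZr// -hE.
  have cg4 : {within `[0, 1], continuous
      (fun z => - (gamma z / 2) * X z + gamma z / 2 * X u)}.
    move=> z; apply: cvgD; first exact: cgX.
    by apply: cvgM; [exact: cg2|exact: cvg_cst].
  have cg5 : {within `[0, 1], continuous (fun z => om * (gamma z / 2))}.
    by move=> z; apply: cvgM; [exact: cvg_cst|exact: cg2].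
  apply: le_trans (le_normr_Rintegral _ _) _ => //.
    exact: (integrable_within_itv cg4).
  rewrite hE -RintegralZl//; apply: le_Rintegral => //.
  - apply: (@integrable_within_itv
      (fun z => `|- (gamma z / 2) * X z + gamma z / 2 * X u|) 0 1) => // z.
    by have := cg4 z; exact: cvg_norm.
  - exact: (integrable_within_itv cg5).
  move=> z; rewrite /= in_itv/= => zsu.
  have z01 : 0 <= z <= 1.
    by case/andP: zsu => sz zu; rewrite (le_trans s0 sz) (le_trans zu u1).
  have g2 : 0 < gamma z / 2 by rewrite divr_gt0// gamma_gt0.
  rewrite mulNr addrC -mulrBr normrM gtr0_norm//.
  by rewrite [leLHS]mulrC ler_pM2r// Xom.
rewrite (_ : _ - _ = growth s * ((expR h - 1 - h) * X u + (J + h * X u))); last by ring.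
rewrite normrM gtr0_norm ?growth_gt0//.
rewrite (_ : growth s * expR h - growth s = growth s * (expR h - 1)); last by ring.
rewrite -mulrA ler_pM2l ?growth_gt0//.
have e1 : h <= expR h - 1 by have := expR_ge1Dx h; lra.
have om0 : 0 <= om.
  by apply: le_trans (Xom u _) => //; rewrite su lexx.
apply: le_trans (ler_normD _ _) _; rewrite mulrDr; apply: lerD; last first.
  by apply: le_trans JE _; rewrite mulrC ler_wpM2r.
rewrite normrM ger0_norm; last lra.
rewrite mulrA (mulrC _ h); apply: ler_pM => //; first lra.
exact: expR_sub1_le.
Qed.

(** The analogous step for the square, whose logarithm grows by the full increment of [cumul]; [S]
    stands for a Riemann sum of [gamma] over [s, u]. *)
Lemma growth_sqr_step (s u S om : R) : 0 <= s -> s <= u -> u <= 1 ->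
  `|cumul u - cumul s - S| <= om * (u - s) ->
  `|growth u ^+ 2 - growth s ^+ 2 - growth s ^+ 2 * S| <=
  (growth u ^+ 2 - growth s ^+ 2) * (cumul u - cumul s) +
  growth s ^+ 2 * (om * (u - s)).
Proof.
move=> s0 su u1 hS; set h := cumul u - cumul s.
have h0 : 0 <= h by rewrite subr_ge0 cumul_le.
have -> : growth u ^+ 2 = growth s ^+ 2 * expR h.
  by rewrite /growth !expr2 -!expRD; congr expR; rewrite /h; field.
have g0 : 0 < growth s ^+ 2 by rewrite exprn_gt0// growth_gt0.
rewrite (_ : _ - _ = growth s ^+ 2 * ((expR h - 1 - h) + (h - S))); last by ring.
rewrite normrM gtr0_norm//.
rewrite (_ : _ + _ = growth s ^+ 2 * ((expR h - 1) * h + om * (u - s))); last by ring.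
rewrite ler_pM2l//; apply: le_trans (ler_normD _ _) _; apply: lerD => //.
rewrite ger0_norm; first by rewrite mulrC; exact: expR_sub1_le.
by have := expR_ge1Dx h; lra.
Qed.

End exponential_integrator.

(** These are the sampling points of [riemann_sum]: the index m means m.+1 cells. *)
Definition grid {R : realType} (a b : R) (m k : nat) : R :=
  a + (b - a) * k%:R / m.+1%:R.

Section grid_theory.
Context {R : realType}.
Implicit Types (a b : R) (m k : nat).

Lemma grid0 a b m : grid a b m 0 = a.
Proof. by rewrite /grid mulr0 mul0r addr0. Qed.

Lemma grid_last a b m : grid a b m m.+1 = b.
Proof. by rewrite /grid -mulrA divff ?pnatr_eq0// mulr1 addrC subrK. Qed.

Lemma gridS a b m k : grid a b m k.+1 - grid a b m k = (b - a) / m.+1%:R.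
Proof.
rewrite /grid opprD addrACA subrr add0r -mulrBl -mulrBr -natr1 addrAC subrr.
by rewrite add0r mulr1.
Qed.

Lemma grid_le a b m : a <= b -> {homo grid a b m : j k / (j <= k)%N >-> j <= k}.
Proof.
move=> ab j k jk; rewrite /grid lerD2l ler_pM2r ?invr_gt0 ?ltr0n//.
by rewrite ler_wpM2l ?subr_ge0// ler_nat.
Qed.

Lemma grid_bounds a b m k : a <= b -> (k <= m.+1)%N -> a <= grid a b m k <= b.
Proof.
move=> ab km; have := grid_le m ab (leq0n k); have := grid_le m ab km.
by rewrite grid0 grid_last => -> ->.
Qed.

End grid_theory.

(** * Errors summed along one sample path *)

Section one_path.
Context {R : realType}.
Notation mu := (@lebesgue_measure R).
Variables (gamma : R -> R) (t G : R).
Hypothesis gamma_cont : {within `[0, 1], continuous gamma}.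
Hypothesis gamma_gt0 : forall s, 0 <= s <= 1 -> 0 < gamma s.
Hypothesis gamma_le : forall s, 0 <= s <= 1 -> gamma s <= G.
Hypothesis t01 : 0 < t <= 1.

(** Each one-step error carries an increment of [growth] as a factor, and these increments add up to
    [growth gamma t - 1] for every mesh. *)
Lemma sum_growth_step (X : R -> R) (M om : R) (m : nat) :
  {within `[0, 1], continuous X} ->
  (forall s, 0 <= s <= 1 -> `|X s| <= M) ->
  (forall s u, 0 <= s <= 1 -> 0 <= u <= 1 -> `|s - u| <= t / m.+1%:R ->
    `|X s - X u| <= om) ->
  `|growth gamma t * X t - X 0 - \sum_(k < m.+1) growth gamma (grid 0 t m k) *
     (X (grid 0 t m k.+1) - (X (grid 0 t m k) +
        \int[mu]_(z in `[grid 0 t m k, grid 0 t m k.+1]) (- (gamma z / 2) * X z)))|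
  <= (growth gamma t - 1) * (G * (t / m.+1%:R) / 2 * M + om).
Proof.
case/andP: t01 => t0 t1 cX XM Xom.
have d0 : 0 <= t / m.+1%:R by rewrite divr_ge0// ltW.
pose g k := grid 0 t m k.
have gb k : (k <= m.+1)%N -> 0 <= g k <= 1.
  by move=> km; have /andP[-> /le_trans->] := grid_bounds (ltW t0) km.
have gle k : g k <= g k.+1 by rewrite grid_le// ltW.
have gS k : g k.+1 - g k = t / m.+1%:R by rewrite /g gridS subr0.
have M0 : 0 <= M by apply: le_trans (XM 0 _) => //; rewrite lexx ler01.
have tele (F : R -> R) : F t - F 0 = \sum_(k < m.+1) (F (g k.+1) - F (g k)).
  rewrite -(big_mkord xpredT (fun k => F (g k.+1) - F (g k))) telescope_sumr//.
  by rewrite /g grid_last grid0.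
have -> : X 0 = growth gamma 0 * X 0 by rewrite growth0 mul1r.
rewrite (tele (fun s => growth gamma s * X s)) -sumrB.
apply: le_trans (ler_norm_sum _ _ _) _.
have -> : growth gamma t - 1 = growth gamma t - growth gamma 0.
  by rewrite growth0.
rewrite (tele (growth gamma)) mulr_suml; apply: ler_sum => k _.
have k1 : (k < m.+1)%N by [].
have /andP[gk0 _] := gb k (ltnW k1); have /andP[_ gk1] := gb k.+1 k1.
have hstep : forall z, g k <= z <= g k.+1 -> `|X (g k.+1) - X z| <= om.
  move=> z /andP[gz zg]; apply: Xom; first exact: gb.
    by rewrite (le_trans gk0 gz) (le_trans zg gk1).
  by rewrite -(gS k) ger0_norm ?subr_ge0// lerD2l lerN2.
have := growth_step gamma_cont gamma_gt0 cX gk0 (gle k) gk1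
  (XM _ (gb _ k1)) hstep.
move=> /le_trans; apply.
apply: ler_wpM2l; first by rewrite subr_ge0 growth_le.
rewrite lerD2r ler_wpM2r// ler_pM2r ?invr_gt0// -(gS k).
exact: cumul_lip.
Qed.

(** The nested sum is the variance of the discretised noise. The bound is free of l, which allows l
    to be chosen after m. *)
Lemma sum_growth_sqr_step (om : R) (m l : nat) :
  (forall s u, 0 <= s <= 1 -> 0 <= u <= 1 -> `|s - u| <= t / m.+1%:R ->
    `|gamma s - gamma u| <= om) ->
  `|growth gamma t ^+ 2 - 1 - \sum_(k < m.+1) growth gamma (grid 0 t m k) ^+ 2 *
     (\sum_(i < l.+1) gamma (grid (grid 0 t m k) (grid 0 t m k.+1) l i) *
       ((grid 0 t m k.+1 - grid 0 t m k) / l.+1%:R))|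
  <= (growth gamma t ^+ 2 - 1) * (G * (t / m.+1%:R)) +
     growth gamma t ^+ 2 * (om * t).
Proof.
case/andP: t01 => t0 t1 gom.
pose g k := grid 0 t m k.
have gb k : (k <= m.+1)%N -> 0 <= g k <= 1.
  by move=> km; have /andP[-> /le_trans->] := grid_bounds (ltW t0) km.
have gle k : g k <= g k.+1 by rewrite grid_le// ltW.
have gS k : g k.+1 - g k = t / m.+1%:R by rewrite /g gridS subr0.
have om0 : 0 <= om.
  have h01 : 0 <= (0 : R) <= 1 by rewrite lexx ler01.
  apply: le_trans (gom 0 0 h01 h01 _); rewrite subrr normr0//.
  by rewrite divr_ge0// ltW.
have tele (F : R -> R) : F t - F 0 = \sum_(k < m.+1) (F (g k.+1) - F (g k)).
  rewrite -(big_mkord xpredT (fun k => F (g k.+1) - F (g k))) telescope_sumr//.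
  by rewrite /g grid_last grid0.
have -> : growth gamma t ^+ 2 - 1 = growth gamma t ^+ 2 - growth gamma 0 ^+ 2.
  by rewrite growth0 expr1n.
rewrite (tele (fun s => growth gamma s ^+ 2)) -sumrB.
apply: le_trans (ler_norm_sum _ _ _) _.
have -> : om * t = \sum_(k < m.+1) om * (g k.+1 - g k).
  by rewrite -mulr_sumr -(tele id) subr0.
rewrite mulr_suml mulr_sumr -big_split/=; apply: ler_sum => k _.
have k1 : (k < m.+1)%N by [].
have /andP[gk0 gk0'] := gb k (ltnW k1); have /andP[_ gk1] := gb k.+1 k1.
pose h i := grid (g k) (g k.+1) l i.
have hb i : (i <= l.+1)%N -> g k <= h i <= g k.+1.
  by move=> il; exact: grid_bounds.
have hle i : h i <= h i.+1 by exact: grid_le.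
have hS i : h i.+1 - h i = (g k.+1 - g k) / l.+1%:R by rewrite /h gridS.
apply: le_trans (growth_sqr_step (om := om) gamma_cont gamma_gt0 gk0 (gle k) gk1 _) _.
  (* The increment of [cumul] is split along the inner grid, on whose cells [gamma] stays within
     [om] of its left value. *)
  have -> : cumul gamma (g k.+1) - cumul gamma (g k) =
      \sum_(i < l.+1) (cumul gamma (h i.+1) - cumul gamma (h i)).
    rewrite -(big_mkord xpredT (fun i => cumul gamma (h i.+1) - cumul gamma (h i))).
    by rewrite telescope_sumr// /h grid_last grid0.
  rewrite [X in _ <= _ * X](_ : _ = \sum_(i < l.+1) (h i.+1 - h i)); last first.
    rewrite -(big_mkord xpredT (fun i => h i.+1 - h i)).
    by rewrite telescope_sumr// /h grid_last grid0.
  rewrite -sumrB mulr_sumr; apply: le_trans (ler_norm_sum _ _ _) _.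
  apply: ler_sum => i _.
  have /andP[hi0 hi0'] := hb i (ltnW (ltn_ord i)).
  have /andP[hi1' hi1] := hb i.+1 (ltn_ord i).
  have hi00 := le_trans gk0 hi0; have hi11 := le_trans hi1 gk1.
  rewrite (cumul_itv gamma_cont hi00 (hle i) hi11) -[(_ - _) / l.+1%:R](hS i).
  apply: Rintegral_itv_near_cst => //.
    exact: (integrable_within_itv gamma_cont).
  move=> z /andP[hz zh]; apply: gom.
  - by rewrite (le_trans hi00 hz) (le_trans zh hi11).
  - by rewrite hi00 (le_trans _ hi11)// hle.
  rewrite ger0_norm ?subr_ge0// -(gS k); apply: lerB => //.
  exact: le_trans zh hi1.
apply: lerD.
  apply: ler_wpM2l.
    by rewrite subr_ge0 ler_sqr ?nnegrE ?(ltW (growth_gt0 _ _))// growth_le.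
  by rewrite -(gS k) cumul_lip.
apply: ler_wpM2r; first by rewrite mulr_ge0// subr_ge0.
rewrite ler_sqr ?nnegrE ?(ltW (growth_gt0 _ _))// growth_le//.
by have /andP[] := grid_bounds (ltW t0) (ltnW k1).
Qed.

End one_path.

(** * Approximation of the noise by Wiener increments *)

Section probability_bounds.
Context {d : measure_display} {Om : measurableType d} {R : realType}.
Variable P : probability Om R.

Lemma probability_union_bound (B : nat -> set Om) (m : nat) (del : R) :
  (forall k, (k < m)%N -> measurable (B k)) ->
  (forall k, (k < m)%N -> (P (B k) <= del%:E)%E) ->
  (P [set w | exists2 k, (k < m)%N & B k w] <= (m%:R * del)%:E)%E.
Proof.
elim: m => [|m IH] mB hB.
  by rewrite mul0r (_ : mkset _ = set0) ?measure0//; apply/seteqP; split=> w // [].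
have mU : measurable [set w | exists2 k, (k < m)%N & B k w].
  rewrite (_ : mkset _ = \bigcup_(k in [set k | (k < m)%N]) B k).
    by apply: bigcup_measurable => k km; exact/mB/ltnW.
  by apply/seteqP; split=> w [k km Bk]; exists k.
rewrite (_ : mkset _ = [set w | exists2 k, (k < m)%N & B k w] `|` B m); last first.
  apply/seteqP; split=> w /=.
    move=> [k]; rewrite ltnS leq_eqVlt => /predU1P[->|km] Bk; first by right.
    by left; exists k.
  by move=> [[k km Bk]|Bm]; [exists k => //; exact: ltnW|exists m].
apply: le_trans (measureU2 _ mU (mB m (ltnSn m))) _.
rewrite -natr1 mulrDl mul1r EFinD; apply: leeD; last exact: hB.
by apply: IH => k km; [exact/mB/ltnW|exact/hB/ltnW].
Qed.

(** The unions of the tails of [F] decrease to its limit superior, which is null by hypothesis;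
    continuity from above concludes. *)
Lemma ae_eventually_probability (F : nat -> set Om) :
  (forall m, measurable (F m)) ->
  {ae P, forall w, exists m0, forall m, (m0 <= m)%N -> ~ F m w} ->
  forall e : R, 0 < e -> exists m0, forall m, (m0 <= m)%N -> (P (F m) < e%:E)%E.
Proof.
move=> mF [N [mN PN sN]] e e0.
pose G m := \bigcup_(k in [set k | (m <= k)%N]) F k.
have mG m : measurable (G m) by apply: bigcup_measurable.
have mI : measurable (\bigcap_m G m) by apply: bigcapT_measurable.
have PI : P (\bigcap_m G m) = 0%E.
  apply/eqP; rewrite eq_le measure_ge0 andbT -PN le_measure ?inE//.
  move=> w Gw; apply: sN => -[m0 hm0].
  by have [k /= mk Fk] := Gw m0 I; exact: hm0 Fk.
have cG : P \o G @ \oo --> P (\bigcap_m G m).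
  apply: nonincreasing_cvg_mu => //.
    by apply: le_lt_trans (probability_le1 _ _) _; rewrite ?ltry.
  move=> m k mk; apply/subsetPset => w [j /= kj Fj]; exists j => //=.
  exact: leq_trans kj.
rewrite PI in cG.
have e0' : (0 < e%:E :> \bar R)%E by rewrite lte_fin.
have [m0 _ hm0] := cG _ (open_ereal_lt' e0').
exists m0 => m m0m; apply: le_lt_trans (hm0 m m0m).
by apply: le_measure; rewrite ?inE// => w Fw; exists m => //=.
Qed.

End probability_bounds.

Section approximation.
Context {R : realType} {n : nat} {d : measure_display} {Om : measurableType d}.
Notation mu := (@lebesgue_measure R).
Variables (P : probability Om R) (W X : R -> Om -> 'rV[R]_n).
Variables (gamma : R -> R) (t : R).
Hypothesis gamma_cont : {within `[0, 1], continuous gamma}.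
Hypothesis gamma_gt0 : forall s, 0 <= s <= 1 -> 0 < gamma s.
Hypothesis t01 : 0 < t <= 1.
Hypothesis X_sde : sde_solution P (fwd_drift gamma) (fwd_diffusion gamma) W X.

(** This replaces Ito's product rule: the SDE identifies the integral over a cell with the increment
    of X minus the integrated drift, and [sum_growth_step] applies to each coordinate of a fixed
    continuous path. *)
Lemma growth_cvg : exists I : nat -> nat -> Om -> 'rV[R]_n,
  (forall m k, (k <= m)%N -> stochastic_integral P (fwd_diffusion gamma) W
     (grid 0 t m k) (grid 0 t m k.+1) (I m k)) /\
  {ae P, forall w, forall e : R, 0 < e -> exists m0, forall m, (m0 <= m)%N ->
     `|growth gamma t *: X t w - X 0 w -
       \sum_(k < m.+1) growth gamma (grid 0 t m k) *: I m k w| < e}.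
Proof.
have [t0 t1] := andP t01.
have [_ [mX cX] _ _ Xeq] := X_sde.
have gb m k : (k <= m.+1)%N -> 0 <= grid 0 t m k <= 1.
  by move=> km; have /andP[-> /le_trans->] := grid_bounds (ltW t0) km.
have gle m k : grid 0 t m k <= grid 0 t m k.+1 by rewrite grid_le// ltW.
(* The SDE only asserts that an integral exists on each cell, so one is chosen for every pair; pairs
   outside the grid carry no requirement. *)
have /choice[I HI] : forall mk : nat * nat, exists I, (mk.2 <= mk.1)%N ->
    stochastic_integral P (fwd_diffusion gamma) W
      (grid 0 t mk.1 mk.2) (grid 0 t mk.1 mk.2.+1) I /\
    {ae P, forall w, X (grid 0 t mk.1 mk.2.+1) w = X (grid 0 t mk.1 mk.2) w +
       \row_i (\int[mu]_(u in `[grid 0 t mk.1 mk.2, grid 0 t mk.1 mk.2.+1])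
                 fwd_drift gamma (X u w) u 0 i) + I w}.
  move=> [m k] /=; have [km|km] := leqP k m; last by exists (fun=> 0).
  have /andP[g0 _] := gb m k (leqW km).
  have /andP[_ g1] := gb m k.+1 km.
  by have [I HI] := Xeq _ _ g0 (gle m k) g1; exists I.
exists (fun m k => I (m, k)); split; first by move=> m k km; have [] := HI (m, k) km.
have HIae : {ae P, forall w, forall m k, (k <= m)%N ->
    X (grid 0 t m k.+1) w = X (grid 0 t m k) w +
       \row_i (\int[mu]_(u in `[grid 0 t m k, grid 0 t m k.+1])
                 fwd_drift gamma (X u w) u 0 i) + I (m, k) w}.
  (* Only countably many null sets occur, so almost every path satisfies the cell equations of all
     grids at once. *)
  apply: ae_foralln => m; apply: ae_foralln => k.
  have [km|km] := leqP k m; last by apply: aeW.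
  by have [_] := HI (m, k) km; apply: filterS => w /= h _.
have [G G0 hG] := gamma_bounded gamma_cont.
apply: filterS2 cX HIae => w cXw HIw e e0.
have cXi i : {within `[0, 1], continuous (fun s => X s w 0 i)}.
  move=> s; have := cXw s => h.
  exact: (continuous_comp h (@coord_continuous R 1 n 0 i _)).
have [M M0 hM] : exists2 M, 0 < M & forall s, 0 <= s <= 1 -> `|X s w| <= M.
  have /compact_bounded : compact ((fun s => X s w) @` `[0, 1]).
    by apply: continuous_compact => //; exact: segment_compact.
  move=> [M [Mreal HM]]; exists (Num.max 1 (M + 1)); first by rewrite lt_max ltr01.
  move=> s s01; rewrite le_max; apply/orP; right; apply: HM; first by rewrite ltrDl.
  by exists s => //=; rewrite in_itv.
(* Makes the final bound [growth gamma t * (om + om)] equal to e / 2. *)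
pose om := e / (4 * growth gamma t).
have om0 : 0 < om by rewrite divr_gt0// mulr_gt0// growth_gt0.
have [th th0 hth] := unif_continuous_itv om0 cXw.
(* The mesh must resolve the modulus of continuity of the path and keep the term G * mesh / 2 * M
   below [om]. *)
pose b := Num.min th (om / (G / 2 * M)).
have b0 : 0 < b by rewrite lt_min th0 divr_gt0// !mulr_gt0.
have [m0 hm0] : exists m0 : nat, forall m, (m0 <= m)%N -> t / m.+1%:R < b.
  exists (Num.truncn (t / b)) => m hm.
  rewrite ltr_pdivrMr ?ltr0n// mulrC -ltr_pdivrMr//.
  apply: lt_le_trans (truncnS_gt _) _; rewrite ler_nat ltnS//.
exists m0 => m m0m; have := hm0 m m0m; rewrite lt_min => /andP[mth mom].
apply/norm_rV_ltP => // i.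
have XMi s : 0 <= s <= 1 -> `|X s w 0 i| <= M.
  by move=> s01; have /norm_rV_leP := hM s s01; apply; exact: ltW.
have Xomi s u : 0 <= s <= 1 -> 0 <= u <= 1 -> `|s - u| <= t / m.+1%:R ->
    `|X s w 0 i - X u w 0 i| <= om.
  move=> s01 u01 su; have /(_ (le_lt_trans su mth)) := hth s u s01 u01.
  by move=> /ltW/norm_rV_leP => /(_ (ltW om0) i); rewrite !mxE.
have := sum_growth_step gamma_cont gamma_gt0 hG t01 (cXi i) XMi Xomi.
rewrite !mxE summxE.
set S1 := \sum_(k < m.+1) _; set S2 := \sum_(k < m.+1) _.
have -> : S1 = S2.
  apply: eq_bigr => k _; rewrite !mxE.
  have km : (k <= m)%N by rewrite -ltnS.
  rewrite (HIw m k km) !mxE.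
  have -> : \int[mu]_(z in `[grid 0 t m k, grid 0 t m k.+1])
        fwd_drift gamma (X z w) z 0 i =
      \int[mu]_(z in `[grid 0 t m k, grid 0 t m k.+1])
        (- (gamma z / 2) * X z w 0 i).
    by apply: eq_Rintegral => z _; rewrite /fwd_drift mxE.
  by congr (_ * _); ring.
move=> /le_lt_trans; apply.
have g1 : 1 <= growth gamma t.
  have := growth_le gamma_cont gamma_gt0 (lexx 0) (ltW t0) t1.
  by rewrite growth0.
apply: (@le_lt_trans _ _ (growth gamma t * (om + om))).
  apply: ler_pM => //; first by rewrite subr_ge0.
  - apply: addr_ge0; last exact: ltW.
    by rewrite mulr_ge0 ?(ltW M0)// divr_ge0// mulr_ge0 ?(ltW G0)// divr_ge0 ?(ltW t0).
  - by rewrite gerBl.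
  rewrite lerD2r; have : t / m.+1%:R * (G / 2 * M) <= om.
    by rewrite -ler_pdivlMr ?(ltW mom)// mulr_gt0 ?divr_gt0.
  by move=> h; apply: le_trans h; rewrite le_eqVlt; apply/orP; left; apply/eqP; ring.
have -> : growth gamma t * (om + om) = e / 2.
  by rewrite /om; field; rewrite gt_eqF// growth_gt0.
by rewrite ltr_pdivrMr// ltr_pMr// ltr1n.
Qed.

Definition increment_coef (m l k i : nat) : R :=
  growth gamma (grid 0 t m k) *
  fwd_diffusion gamma (grid (grid 0 t m k) (grid 0 t m k.+1) l i).

(** Variance of each coordinate of [increment_sum], by independence of the Wiener increments. *)
Definition variance_sum (m l : nat) : R :=
  \sum_(k < m.+1) \sum_(i < l.+1) increment_coef m l k i ^+ 2 *
    (grid (grid 0 t m k) (grid 0 t m k.+1) l i.+1 -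
     grid (grid 0 t m k) (grid 0 t m k.+1) l i).

Definition increment_sum (m l : nat) (w : Om) : 'rV[R]_n :=
  \sum_(k < m.+1) growth gamma (grid 0 t m k) *:
    riemann_sum (fwd_diffusion gamma) W (grid 0 t m k) (grid 0 t m k.+1) l w.

Let gb m k : (k <= m.+1)%N -> 0 <= grid 0 t m k <= 1.
Proof.
have [t0 t1] := andP t01.
by move=> km; have /andP[-> /le_trans->] := grid_bounds (ltW t0) km.
Qed.

Let gle m k : grid 0 t m k <= grid 0 t m k.+1.
Proof. by have [t0 t1] := andP t01; rewrite grid_le// ltW. Qed.

Lemma variance_sum_near (e : R) : 0 < e -> exists m0, forall m, (m0 <= m)%N ->
  forall l, `|growth gamma t ^+ 2 - 1 - variance_sum m l| <= e.
Proof.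
move=> e0; have [t0 t1] := andP t01.
have [G G0 hG] := gamma_bounded gamma_cont.
pose g2 := growth gamma t ^+ 2.
have g20 : 0 < g2 by rewrite exprn_gt0// growth_gt0.
(* Each of the two error terms of [sum_growth_sqr_step] is then at most [g2 * om], that is e / 2. *)
pose om := e / (2 * g2).
have om0 : 0 < om by rewrite divr_gt0// mulr_gt0.
have [th th0 hth] := unif_continuous_itv om0 gamma_cont.
pose b := Num.min th (om / G).
have b0 : 0 < b by rewrite lt_min th0 divr_gt0.
exists (Num.truncn (t / b)) => m hm l.
have : t / m.+1%:R < b.
  rewrite ltr_pdivrMr ?ltr0n// mulrC -ltr_pdivrMr//.
  by apply: lt_le_trans (truncnS_gt _) _; rewrite ler_nat ltnS.
rewrite lt_min => /andP[mth mom].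
have gom s u : 0 <= s <= 1 -> 0 <= u <= 1 -> `|s - u| <= t / m.+1%:R ->
    `|gamma s - gamma u| <= om.
  by move=> s01 u01 su; apply/ltW/hth => //; exact: le_lt_trans su mth.
have := sum_growth_sqr_step gamma_cont gamma_gt0 hG t01 l gom.
set S1 := \sum_(k < m.+1) _ => h.
have -> : variance_sum m l = S1.
  apply: eq_bigr => k _; rewrite mulr_sumr; apply: eq_bigr => i _.
  have km : (k < m.+1)%N by [].
  have /andP[hi0 hi1] := grid_bounds (gle m k) (ltnW (ltn_ord i)).
  have /andP[g0 _] := gb (ltnW km); have /andP[_ g1] := gb km.
  rewrite gridS /increment_coef /fwd_diffusion exprMn sqr_sqrtr ?mulrA//.
  by apply/ltW/gamma_gt0; rewrite (le_trans g0 hi0) (le_trans hi1 g1).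
apply: (le_trans h).
have h1 : G * (t / m.+1%:R) <= om by rewrite mulrC -ler_pdivlMr// ltW.
have h2 : 0 <= G * (t / m.+1%:R) by rewrite mulr_ge0 ?divr_ge0// ltW.
have h3 : om * t <= om by rewrite ler_piMr// ltW.
have h4 : 0 <= om * t by rewrite mulr_ge0// ltW.
have h5 : om * g2 = e / 2 by rewrite /om; field; rewrite gt_eqF.
apply: (@le_trans _ _ (g2 * om + g2 * om)); last by rewrite mulrC h5; lra.
apply: lerD; last by rewrite ler_pM2l.
have h6 : 1 <= g2.
  have := growth_le gamma_cont gamma_gt0 (lexx 0) (ltW t0) t1.
  by rewrite growth0 /g2 => g1; rewrite exprn_ege1.
apply: ler_pM => //; first by rewrite subr_ge0.
by rewrite gerBl.
Qed.

Lemma measurable_sde_noise : measurable_fun setT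
  (fun w => growth gamma t *: X t w - X 0 w).
Proof.
have [_ [mX _] _ _ _] := X_sde; have [t0 t1] := andP t01.
by apply: measurable_rVB; [apply: measurable_rVZ|]; apply: mX;
  rewrite ?lexx ?ler01// ltW.
Qed.

Lemma measurable_riemann_sum m l k : (k < m.+1)%N -> measurable_fun setT
  (riemann_sum (fwd_diffusion gamma) W (grid 0 t m k) (grid 0 t m k.+1) l).
Proof.
have [[mW _ _ _ _] _ _ _ _] := X_sde; move=> km.
pose h i := grid (grid 0 t m k) (grid 0 t m k.+1) l i.
apply: (@measurable_rV_sum _ _ _ _ l.+1 (fun i w => fwd_diffusion gamma (h i) *:
  (W (h i.+1) w - W (h i) w))) => i il.
have h01 j : (j <= l.+1)%N -> 0 <= h j <= 1.
  move=> jl; have /andP[h0 h1] := grid_bounds (gle m k) jl.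
  have /andP[g0 _] := gb (ltnW km); have /andP[_ g1] := gb km.
  by rewrite (le_trans g0 h0) (le_trans h1 g1).
apply: measurable_rVZ; apply: measurable_rVB; apply: mW; apply: h01 => //.
exact: ltnW.
Qed.

Lemma measurable_increment_sum m l : measurable_fun setT (increment_sum m l).
Proof.
apply: (@measurable_rV_sum _ _ _ _ m.+1 (fun k w => growth gamma (grid 0 t m k) *:
  riemann_sum (fwd_diffusion gamma) W (grid 0 t m k) (grid 0 t m k.+1) l w)).
by move=> k km; apply: measurable_rVZ; exact: measurable_riemann_sum.
Qed.

(** First m is fixed by the pathwise convergence and the variance bound, then l by the convergence
    in probability of the Riemann sums on the m.+1 cells; each stage costs e / 2 in distance and in
    probability. *)
Lemma increment_sum_near (e : R) : 0 < e -> exists m l,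
  (P [set w | (e <= `|growth gamma t *: X t w - X 0 w - increment_sum m l w|)%R]
    <= e%:E)%E /\ `|growth gamma t ^+ 2 - 1 - variance_sum m l| <= e.
Proof.
move=> e0; have [t0 t1] := andP t01.
have [I [HI HIae]] := growth_cvg.
have [m1 hm1] := variance_sum_near e0.
pose N w := growth gamma t *: X t w - X 0 w.
pose Nm m w := \sum_(k < m.+1) growth gamma (grid 0 t m k) *: I m k w.
have mNm m : measurable_fun setT (Nm m).
  apply: (@measurable_rV_sum _ _ _ _ m.+1
    (fun k w => growth gamma (grid 0 t m k) *: I m k w)) => k km.
  by apply: measurable_rVZ; have [] := HI m k km.
pose F m := [set w | e / 2 <= `|N w - Nm m w|].
have mF m : measurable (F m).
  apply: measurable_rV_norm_ge; apply: measurable_rVB => //.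
  exact: measurable_sde_noise.
have e2 : 0 < e / 2 by rewrite divr_gt0.
have aeF : {ae P, forall w, exists m0, forall m, (m0 <= m)%N -> ~ F m w}.
  apply: filterS HIae => w /(_ _ e2)[m0 hm0]; exists m0 => m m0m.
  by rewrite /F/= => /(lt_le_trans (hm0 m m0m)); rewrite ltxx.
have [m2 hm2] := ae_eventually_probability mF aeF e2.
pose m := maxn m1 m2.
have gt := growth_gt0 gamma t.
(* The m.+1 cells, each weighted by at most [growth gamma t], contribute e / 2 in total. *)
pose e' := e / (2 * growth gamma t * m.+1%:R).
have e'0 : 0 < e' by rewrite divr_gt0// !mulr_gt0.
have e''0 : 0 < e / (2 * m.+1%:R) by rewrite divr_gt0// mulr_gt0.
pose B l k := [set w | e' <= `|I m k w - riemann_sum (fwd_diffusion gamma) W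
  (grid 0 t m k) (grid 0 t m k.+1) l w|].
have /choice[l0 hl0] : forall k, exists l0, (k <= m)%N ->
    forall l, (l0 <= l)%N -> (P (B l k) <= (e / (2 * m.+1%:R))%:E)%E.
  move=> k.
  have [km|km] := leqP k m; last by exists 0%N.
  have [_ /(_ _ e'0) cv] := HI m k km.
  have e''0' : (0 < (e / (2 * m.+1%:R))%:E :> \bar R)%E by rewrite lte_fin.
  have [l0 _ hl0] := cv _ (open_ereal_lt' e''0').
  by exists l0 => _ l l0l; apply/ltW/(hl0 l).
(* With m fixed there are finitely many thresholds. *)
pose l := \max_(k < m.+1) l0 k.
exists m, l; split; last by apply: hm1; rewrite leq_maxl.
have mB k : (k < m.+1)%N -> measurable (B l k).
  move=> km; apply: measurable_rV_norm_ge; apply: measurable_rVB.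
    by have [] := HI m k km.
  exact: measurable_riemann_sum.
have PB : (P [set w | exists2 k, (k < m.+1)%N & B l k w] <= (e / 2)%:E)%E.
  have -> : e / 2 = m.+1%:R * (e / (2 * m.+1%:R)).
    have : m.+1%:R != 0 :> R by rewrite pnatr_eq0.
    by move: m.+1%:R => M M0; field.
  apply: probability_union_bound => // k km; apply: hl0 => //.
  exact: (@leq_bigmax _ (fun i : 'I_m.+1 => l0 i) (Ordinal km)).
have mBU : measurable [set w | exists2 k, (k < m.+1)%N & B l k w].
  rewrite (_ : mkset _ = \bigcup_(k in [set k | (k < m.+1)%N]) B l k).
    by apply: bigcup_measurable.
  by apply/seteqP; split=> w [k km Bk]; exists k.
have sub : [set w | e <= `|N w - increment_sum m l w|] `<=`
    F m `|` [set w | exists2 k, (k < m.+1)%N & B l k w].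
  move=> w /= Ne; have [?|NF] := leP (e / 2) `|N w - Nm m w|; first by left.
  right; apply: contrapT => nB; move: Ne; apply/negP; rewrite -ltNge.
  apply: (le_lt_trans (ler_distD (Nm m w) _ _)).
  have -> : e = e / 2 + e / 2 by lra.
  apply: ltr_leD => //; rewrite /Nm /increment_sum -sumrB.
  have -> : e / 2 = \sum_(k < m.+1) growth gamma t * e'.
    rewrite sumr_const card_ord /e' -[RHS]mulr_natr.
    have : m.+1%:R != 0 :> R by rewrite pnatr_eq0.
    by move: m.+1%:R => M M0; field; rewrite M0 gt_eqF.
  apply: le_trans (ler_norm_sum _ _ _) _; apply: ler_sum => k _.
  rewrite -scalerBr normrZ gtr0_norm ?growth_gt0//.
  have km : (k < m.+1)%N by [].
  apply: ler_pM => //; first exact/ltW/growth_gt0.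
    have /andP[g0 _] := gb (ltnW km); apply: growth_le => //.
    by have /andP[] := grid_bounds (ltW t0) (ltnW km).
  apply: contrapT => /negP; rewrite -ltNge => /ltW h.
  by apply: nB; exists k.
apply: (@le_trans _ _ (P (F m `|` [set w | exists2 k, (k < m.+1)%N & B l k w]))).
  apply: le_measure => //; rewrite inE; last exact: measurableU.
  apply: measurable_rV_norm_ge; apply: measurable_rVB.
    exact: measurable_sde_noise.
  exact: measurable_increment_sum.
apply: le_trans (measureU2 _ (mF m) mBU) _.
have -> : e%:E = ((e / 2)%:E + (e / 2)%:E)%E by rewrite -EFinD; congr EFin; lra.
by apply: leeD => //; apply/ltW/hm2; rewrite leq_maxr.
Qed.

End approximation.

(** * Joint law of the initial sample and the noise *)

Lemma sum_flatten (V : nmodType) (F : nat -> nat -> V) (m l : nat) :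
  \sum_(k < m) \sum_(i < l.+1) F k i =
  \sum_(j < m * l.+1) F (j %/ l.+1)%N (j %% l.+1)%N.
Proof.
elim: m => [|m IH]; first by rewrite !big_ord0.
rewrite big_ord_recr/= IH mulSnr big_split_ord/=; congr (_ + _).
apply: eq_bigr => i _.
by rewrite divnMDl// modnMDl divn_small// modn_small// addn0.
Qed.

Section noise_law.
Context {R : realType} {n : nat} {d : measure_display} {Om : measurableType d}.
Variables (P : probability Om R) (W X : R -> Om -> 'rV[R]_n).
Variables (gamma : R -> R) (t : R).
Hypothesis gamma_cont : {within `[0, 1], continuous gamma}.
Hypothesis gamma_gt0 : forall s, 0 <= s <= 1 -> 0 < gamma s.
Hypothesis t01 : 0 < t <= 1.
Hypothesis X_sde : sde_solution P (fwd_drift gamma) (fwd_diffusion gamma) W X.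

(** The two-level grid is one uniform grid of [0, t] with (m+1)(l+1) cells, hence a single monotone
    sequence of times. *)
Lemma grid_grid (m l k i : nat) :
  grid (grid 0 t m k) (grid 0 t m k.+1) l i =
  t * (k * l.+1 + i)%:R / (m.+1 * l.+1)%:R.
Proof.
have m0 : m.+1%:R != 0 :> R by rewrite pnatr_eq0.
have l0 : l.+1%:R != 0 :> R by rewrite pnatr_eq0.
rewrite /grid natrD !natrM -[k.+1%:R]natr1.
by move: m.+1%:R l.+1%:R m0 l0 => M L M0 L0; field; rewrite M0 L0.
Qed.

(** Independence of X_0 concerns values of [W] and the Gaussian law concerns increments, so the sum
    is written in both ways. *)
Lemma increment_sum_law (m l : nat) (A B : set 'rV[R]_n) :
  measurable A -> measurable B ->
  (P (X 0 @^-1` A `&` [set w | B (increment_sum W gamma t m l w)]) =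
   P (X 0 @^-1` A) *
   P [set w | B (Num.sqrt (variance_sum gamma t m l) *: (W 1 w - W 0 w))%R])%E.
Proof.
move=> mA mB; have [t0 t1] := andP t01.
have [Ww [mX _] XW _ _] := X_sde; have [mW _ _ _ _] := Ww.
pose M := (m.+1 * l.+1)%N.
have M0 : (0 < M)%N by rewrite muln_gt0.
have M0' : 0 < M%:R :> R by rewrite ltr0n.
(* The flattened grid, frozen at t after M steps because bounds and monotonicity are required at all
   indices; for the same reason [c] takes the positive value 1 there. *)
pose r j : R := t * (minn j M)%:R / M%:R.
pose c j : R := if (j < M)%N then increment_coef gamma t m l (j %/ l.+1) (j %% l.+1)
  else 1.
have r01 j : 0 <= r j <= 1.
  rewrite /r divr_ge0 ?mulr_ge0 ?(ltW t0)//= ler_pdivrMr// mul1r.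
  rewrite -[leRHS]mul1r; apply: ler_pM => //; first exact: ltW.
  by rewrite ler_nat geq_minr.
have rhomo : {homo r : j k / (j <= k)%N >-> j <= k}.
  move=> j k jk; rewrite /r ler_pM2r ?invr_gt0// ler_pM2l// ler_nat.
  by rewrite leq_min geq_minr andbT (leq_trans (geq_minl _ _)).
(* For i = 1 the inner index may reach l.+1, the right end of the cell, which coincides with the
   start of the next one. *)
have rE j i : (j < M)%N -> (i <= 1)%N ->
    r (j + i)%N = grid (grid 0 t m (j %/ l.+1)) (grid 0 t m (j %/ l.+1).+1) l (j %% l.+1 + i).
  move=> jM i1; rewrite grid_grid addnA -divn_eq /r (minn_idPl _)//.
  by apply: leq_trans jM; rewrite -addn1 leq_add2l.
have rS j : (j < M)%N -> r j < r j.+1.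
  move=> jM; rewrite /r ltr_pM2r ?invr_gt0// ltr_pM2l// ltr_nat.
  by rewrite (minn_idPl jM) (minn_idPl (ltnW jM)).
have c0 j : 0 < c j.
  rewrite /c; case: ifPn => // jM; rewrite mulr_gt0 ?growth_gt0// sqrtr_gt0.
  apply: gamma_gt0.
  by have := rE j 0%N jM (leq0n _); rewrite !addn0 => <-.
have SE w : increment_sum W gamma t m l w =
    \sum_(j < M) c j *: (W (r j.+1) w - W (r j) w).
  transitivity (\sum_(k < m.+1) \sum_(i < l.+1) increment_coef gamma t m l k i *:
    (W (grid (grid 0 t m k) (grid 0 t m k.+1) l i.+1) w -
     W (grid (grid 0 t m k) (grid 0 t m k.+1) l i) w)).
    apply: eq_bigr => k _; rewrite /riemann_sum scaler_sumr.
    by apply: eq_bigr => i _; rewrite scalerA.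
  rewrite (sum_flatten (fun k i => increment_coef gamma t m l k i *:
    (W (grid (grid 0 t m k) (grid 0 t m k.+1) l i.+1) w -
     W (grid (grid 0 t m k) (grid 0 t m k.+1) l i) w))).
  apply: eq_bigr => j _; have jM := ltn_ord j; rewrite /c jM.
  have := rE j 0%N jM (leq0n _); rewrite !addn0 => <-.
  by have := rE j 1%N jM (leqnn _); rewrite !addn1 => <-.
have VE : variance_sum gamma t m l = \sum_(j < M) c j ^+ 2 * (r j.+1 - r j).
  rewrite /variance_sum (sum_flatten (fun k i => increment_coef gamma t m l k i ^+ 2 *
    (grid (grid 0 t m k) (grid 0 t m k.+1) l i.+1 -
     grid (grid 0 t m k) (grid 0 t m k.+1) l i))).
  apply: eq_bigr => j _; have jM := ltn_ord j; rewrite /c jM.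
  have := rE j 0%N jM (leq0n _); rewrite !addn0 => <-.
  by have := rE j 1%N jM (leqnn _); rewrite !addn1 => <-.
(* Increments are split into values of [W]: the first M indices carry the right endpoints, the next
   M the left endpoints with opposite sign. *)
pose e j : R := if (j < M)%N then c j else - c (j - M)%N.
pose q j : R := if (j < M)%N then r j.+1 else r (j - M)%N.
have SE' w : increment_sum W gamma t m l w = \sum_(j < M + M) e j *: W (q j) w.
  rewrite SE big_split_ord/= -big_split/=; apply: eq_bigr => j _.
  by rewrite /e /q/= ltn_ord ltnNge leq_addr/= addKn scalerBr scaleNr.
have q01 j : 0 <= q j <= 1 by rewrite /q; case: ifP.
have mX0 : measurable_fun setT (X 0) by apply: mX; rewrite lexx ler01.
have E1 : [set w | B (increment_sum W gamma t m l w)] =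
    [set w | B (\sum_(j < M + M) e j *: W (q j) w)].
  by apply/seteqP; split=> w /=; rewrite SE'.
rewrite E1 (independent_lincomb _ _ mW XW mX0 q01 mA mB); congr (_ * _)%E.
rewrite -E1 -(wiener_lincomb_law Ww M0 r01 rhomo rS c0 VE mB).
by congr (P _); apply/seteqP; split=> w /=; rewrite SE.
Qed.

Let noise w := growth gamma t *: X t w - X 0 w.
Let sigma := Num.sqrt (growth gamma t ^+ 2 - 1).
(** A representative of the limiting Gaussian law. It is compared with [noise] in distribution only,
    never path by path. *)
Let limit_noise w := sigma *: (W 1 w - W 0 w).

Lemma growth_sqr_gt1 : 0 < growth gamma t ^+ 2 - 1.
Proof.
have [t0 t1] := andP t01.
rewrite subr_gt0 expr_gt1 ?(ltW (growth_gt0 _ _))// /growth -expR0 ltr_expR.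
by rewrite divr_gt0// cumul_gt0.
Qed.

Lemma tail_probability (Z : Om -> 'rV[R]_n) (e : R) : measurable_fun setT Z ->
  0 < e -> exists2 K, 0 < K & (P [set w | (K <= `|Z w|)%R] <= e%:E)%E.
Proof.
move=> mZ e0.
have mF (m : nat) : measurable [set w | m%:R <= `|Z w|].
  exact: measurable_rV_norm_ge.
have [|m0 hm0] := ae_eventually_probability (P := P) mF _ e0.
  apply: aeW => w; exists (Num.truncn `|Z w|).+1 => m hm /=.
  apply/negP; rewrite -ltNge; apply: lt_le_trans (truncnS_gt _) _.
  by rewrite ler_nat.
by exists m0.+1%:R => //; apply/ltW/hm0.
Qed.

Let mW : measurable_fun setT (fun w => W 1 w - W 0 w).
Proof.
have [Ww _ _ _ _] := X_sde; apply: (measurable_wiener_increment Ww).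
  by rewrite lexx ler01.
by rewrite lexx ler01.
Qed.

Lemma noise_approx (e eta : R) : 0 < e -> 0 < eta -> exists m l K,
  [/\ (P [set w | (eta / 2 <= `|noise w - increment_sum W gamma t m l w|)%R]
        <= e%:E)%E,
      (P [set w | (K <= `|W 1 w - W 0 w|)%R] <= e%:E)%E &
      forall w, `|W 1 w - W 0 w| < K ->
        `|limit_noise w - Num.sqrt (variance_sum gamma t m l) *: (W 1 w - W 0 w)|
        <= eta / 2].
Proof.
move=> e0 eta0.
have [K K0 hK] := tail_probability mW e0.
have s2 := growth_sqr_gt1.
have sg0 : 0 < sigma by rewrite sqrtr_gt0.
(* The three bounds serve the probability of the first event, its threshold, and the error on the
   standard deviation, which gets multiplied by at most [K]. *)
pose e1 := Num.min e (Num.min (eta / 2) (eta / 2 * sigma / K)).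
have e10 : 0 < e1.
  by rewrite !lt_min e0 divr_gt0//= divr_gt0// mulr_gt0// divr_gt0.
have [m [l [hP hV]]] := increment_sum_near gamma_cont gamma_gt0 t01 X_sde e10.
exists m, l, K; split=> //.
  apply: le_trans (_ : (P [set w | (e1 <= `|noise w - increment_sum W gamma t m l w|)%R] <= e%:E)%E).
    apply: le_measure; rewrite ?inE.
    - apply: measurable_rV_norm_ge; apply: measurable_rVB.
        exact: (measurable_sde_noise t01 X_sde).
      exact: (measurable_increment_sum t01 X_sde).
    - apply: measurable_rV_norm_ge; apply: measurable_rVB.
        exact: (measurable_sde_noise t01 X_sde).
      exact: (measurable_increment_sum t01 X_sde).
    by move=> w /= h; apply: le_trans h; rewrite !ge_min lexx !orbT.
  by apply: le_trans hP _; rewrite lee_fin ge_min lexx.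
move=> w /ltW wK; rewrite /limit_noise -scalerBl normrZ.
set v := variance_sum _ _ _ _ in hV *.
have v0 : 0 <= v.
  apply: sumr_ge0 => k _; apply: sumr_ge0 => i _; rewrite mulr_ge0 ?sqr_ge0//.
  rewrite gridS divr_ge0// gridS subr0 divr_ge0//.
  by have [/ltW] := andP t01.
(* A variance error becomes a standard deviation error: sigma^2 - v factors as (sigma - sqrt
   v)(sigma + sqrt v), and the second factor is at least [sigma]. *)
have h1 : `|sigma - Num.sqrt v| * sigma <= e1.
  apply: le_trans hV; rewrite -/sigma.
  rewrite -[growth _ _ ^+ 2 - 1]sqr_sqrtr ?(ltW s2)// -{2}(sqr_sqrtr v0) subr_sqr normrM.
  apply: ler_wpM2l => //; rewrite ger0_norm ?addr_ge0 ?sqrtr_ge0//.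
  by rewrite lerDl sqrtr_ge0.
have h2 : `|sigma - Num.sqrt v| <= eta / 2 / K.
  rewrite -(ler_pM2r sg0); apply: le_trans h1 _.
  rewrite /e1 !ge_min; apply/orP; right; apply/orP; right.
  by rewrite mulrAC.
apply: (@le_trans _ _ (eta / 2 / K * K)); last by rewrite divfK// gt_eqF.
by apply: ler_pM.
Qed.

Let mnoise : measurable_fun setT noise.
Proof. exact: (measurable_sde_noise t01 X_sde). Qed.

Let mlimit : measurable_fun setT limit_noise.
Proof. exact: measurable_rVZ. Qed.

(** Passing from [noise] to a finite sum of increments widens the cube by eta / 2 and costs
    probability e / 2; the probability then factors; passing to [limit_noise] costs the same again.
    Only e tends to 0, while [eta] remains in the statement. *)
Lemma le_noise_limit (A : set 'rV[R]_n) (c : 'rV[R]_n) (rho eta : R) :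
  measurable A -> 0 < eta ->
  (P (X 0 @^-1` A `&` [set w | (`|noise w - c| <= rho)%R]) <=
   P (X 0 @^-1` A) * P [set w | (`|limit_noise w - c| <= rho + eta)%R])%E.
Proof.
move=> mA eta0; apply/lee_addgt0Pr => e e0.
have e2 : 0 < e / 2 by rewrite divr_gt0.
have [m [l [K [hS hK hZ]]]] := noise_approx e2 eta0.
have [_ [mX _] _ _ _] := X_sde.
have mX0 : measurable_fun setT (X 0) by apply: mX; rewrite lexx ler01.
have mXA : measurable (X 0 @^-1` A) by rewrite -[X in measurable X]setTI; exact: mX0.
have mS := measurable_increment_sum t01 X_sde m l.
pose Q := [set w | `|increment_sum W gamma t m l w - c| <= rho + eta / 2].
have mQ : measurable (X 0 @^-1` A `&` Q).
  by apply: measurableI => //; exact: measurable_preimage_cube.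
have mD : measurable [set w | eta / 2 <= `|noise w - increment_sum W gamma t m l w|].
  by apply: measurable_rV_norm_ge; exact: measurable_rVB.
have sub1 : X 0 @^-1` A `&` [set w | `|noise w - c| <= rho] `<=`
    (X 0 @^-1` A `&` Q) `|`
    [set w | eta / 2 <= `|noise w - increment_sum W gamma t m l w|].
  move=> w /= [Aw h];
  have [?|hlt] := leP (eta / 2) `|noise w - increment_sum W gamma t m l w|.
    by right.
  left; split=> //; rewrite /Q/=; apply: le_trans (ler_distD (noise w) _ _) _.
  by rewrite addrC lerD// distrC ltW.
apply: le_trans (le_measure _ _ _ sub1) _; rewrite ?inE.
- by apply: measurableI => //; exact: measurable_preimage_cube.
- exact: measurableU.
apply: le_trans (measureU2 _ mQ mD) _.
have -> : e%:E = ((e / 2)%:E + (e / 2)%:E)%E by rewrite -EFinD; congr EFin; lra.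
rewrite addeA; apply: leeD => //.
have := increment_sum_law m l mA (measurable_cube c (rho + eta / 2)).
rewrite /cube/= => ->.
pose Zv := [set w | `|Num.sqrt (variance_sum gamma t m l) *: (W 1 w - W 0 w) - c|
  <= rho + eta / 2].
have mZc : measurable [set w | `|limit_noise w - c| <= rho + eta].
  exact: measurable_preimage_cube.
have mKc : measurable [set w | K <= `|W 1 w - W 0 w|].
  exact: measurable_rV_norm_ge.
have sub2 : Zv `<=` [set w | `|limit_noise w - c| <= rho + eta] `|`
    [set w | K <= `|W 1 w - W 0 w|].
  move=> w; rewrite /Zv/= => h.
  have [?|hlt] := leP K `|W 1 w - W 0 w|; [by right|left].
  apply: le_trans (ler_distD (Num.sqrt (variance_sum gamma t m l) *: (W 1 w - W 0 w)) _ _) _.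
  have -> : rho + eta = eta / 2 + (rho + eta / 2) by lra.
  by apply: lerD => //; exact: hZ.
have PZ : (P Zv <= P [set w | (`|limit_noise w - c| <= rho + eta)%R] + (e / 2)%:E)%E.
  apply: le_trans (le_measure _ _ _ sub2) _; rewrite ?inE.
  - by apply: measurable_preimage_cube; exact: measurable_rVZ.
  - exact: measurableU.
  by apply: le_trans (measureU2 _ mZc mKc) _; apply: leeD.
apply: le_trans (lee_wpmul2l _ PZ) _ => //.
rewrite muleDr ?fin_num_measure//; last by rewrite ge0_adde_def ?inE// lee_fin ltW.
apply: leeD => //; rewrite -[leRHS]mul1e; apply: lee_wpmul2r.
  by rewrite lee_fin ltW.
exact: probability_le1.
Qed.

(** The same two replacements in the opposite order. *)
Lemma le_limit_noise (A : set 'rV[R]_n) (c : 'rV[R]_n) (rho eta : R) :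
  measurable A -> 0 < eta ->
  (P (X 0 @^-1` A) * P [set w | (`|limit_noise w - c| <= rho)%R] <=
   P (X 0 @^-1` A `&` [set w | (`|noise w - c| <= rho + eta)%R]))%E.
Proof.
move=> mA eta0; apply/lee_addgt0Pr => e e0.
have e2 : 0 < e / 2 by rewrite divr_gt0.
have [m [l [K [hS hK hZ]]]] := noise_approx e2 eta0.
have [_ [mX _] _ _ _] := X_sde.
have mX0 : measurable_fun setT (X 0) by apply: mX; rewrite lexx ler01.
have mXA : measurable (X 0 @^-1` A) by rewrite -[X in measurable X]setTI; exact: mX0.
have mS := measurable_increment_sum t01 X_sde m l.
have mN : measurable (X 0 @^-1` A `&` [set w | `|noise w - c| <= rho + eta]).
  by apply: measurableI => //; exact: measurable_preimage_cube.
have mD : measurable [set w | eta / 2 <= `|noise w - increment_sum W gamma t m l w|].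
  by apply: measurable_rV_norm_ge; exact: measurable_rVB.
have mKc : measurable [set w | K <= `|W 1 w - W 0 w|].
  exact: measurable_rV_norm_ge.
pose Zv := [set w | `|Num.sqrt (variance_sum gamma t m l) *: (W 1 w - W 0 w) - c|
  <= rho + eta / 2].
have mZv : measurable Zv.
  by apply: measurable_preimage_cube; exact: measurable_rVZ.
have sub2 : [set w | `|limit_noise w - c| <= rho] `<=` Zv `|`
    [set w | K <= `|W 1 w - W 0 w|].
  move=> w /= h; have [?|hlt] := leP K `|W 1 w - W 0 w|; [by right|left].
  rewrite /Zv/=; apply: le_trans (ler_distD (limit_noise w) _ _) _.
  by rewrite addrC lerD// distrC hZ.
have PZ : (P [set w | (`|limit_noise w - c| <= rho)%R] <= P Zv + (e / 2)%:E)%E.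
  apply: le_trans (le_measure _ _ _ sub2) _; rewrite ?inE.
  - exact: measurable_preimage_cube.
  - exact: measurableU.
  by apply: le_trans (measureU2 _ mZv mKc) _; apply: leeD.
apply: le_trans (lee_wpmul2l _ PZ) _ => //.
rewrite muleDr ?fin_num_measure//; last by rewrite ge0_adde_def ?inE// lee_fin ltW.
have -> : e%:E = ((e / 2)%:E + (e / 2)%:E)%E by rewrite -EFinD; congr EFin; lra.
rewrite addeA; apply: leeD; last first.
  rewrite -[leRHS]mul1e; apply: lee_wpmul2r; first by rewrite lee_fin ltW.
  exact: probability_le1.
have := increment_sum_law m l mA (measurable_cube c (rho + eta / 2)).
rewrite /cube/= => <-.
have sub1 : X 0 @^-1` A `&`
    [set w | `|increment_sum W gamma t m l w - c| <= rho + eta / 2] `<=`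
    (X 0 @^-1` A `&` [set w | `|noise w - c| <= rho + eta]) `|`
    [set w | eta / 2 <= `|noise w - increment_sum W gamma t m l w|].
  move=> w /= [Aw h];
  have [?|hlt] := leP (eta / 2) `|noise w - increment_sum W gamma t m l w|.
    by right.
  left; split=> //; apply: le_trans (ler_distD (increment_sum W gamma t m l w) _ _) _.
  have -> : rho + eta = eta / 2 + (rho + eta / 2) by lra.
  by rewrite lerD// ltW.
apply: le_trans (le_measure _ _ _ sub1) _; rewrite ?inE.
- by apply: measurableI => //; exact: measurable_preimage_cube.
- exact: measurableU.
by apply: le_trans (measureU2 _ mN mD) _; apply: leeD.
Qed.

End noise_law.

(** * The joint density of the clean and the noisy sample *)

Section small_cubes.
Context {R : realType}.

Lemma integral_le_cst d (T : measurableType d) (m : {measure set T -> \bar R})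
    (f : T -> R) (A : set T) (k v : R) : measurable A -> measurable_fun setT f ->
  (forall x, 0 <= f x) -> m A = v%:E -> (forall x, A x -> f x <= k) ->
  (\int[m]_(x in A) (f x)%:E <= (k * v)%:E)%E.
Proof.
move=> mA mf f0 mv fk; rewrite EFinM -mv -integral_cst//.
apply: ge0_le_integral => //.
- by move=> x _; rewrite lee_fin.
- by apply/measurable_EFinP; exact: measurable_funTS.
Qed.

Lemma integral_ge_cst d (T : measurableType d) (m : {measure set T -> \bar R})
    (f : T -> R) (A : set T) (k v : R) : measurable A -> measurable_fun setT f ->
  (forall x, 0 <= f x) -> m A = v%:E -> (forall x, A x -> k <= f x) ->
  ((k * v)%:E <= \int[m]_(x in A) (f x)%:E)%E.
Proof.
move=> mA mf f0 mv fk.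
have v0 : 0 <= v by rewrite -lee_fin -mv.
have [k0|k0] := leP 0 k; last first.
  apply: (@le_trans _ _ 0%E); last by apply: integral_ge0 => x _; rewrite lee_fin.
  by rewrite lee_fin mulr_le0_ge0// ltW.
rewrite EFinM -mv -integral_cst//; apply: ge0_le_integral => //.
by apply/measurable_EFinP; exact: measurable_funTS.
Qed.

Lemma continuous_cube n (f : 'rV[R]_n -> R) (x : 'rV[R]_n) (e : R) :
  continuous f -> 0 < e ->
  exists2 del, 0 < del & forall y, cube x del y -> `|f x - f y| <= e.
Proof.
move=> cf e0; have /cvgrPdist_le /(_ _ e0) := cf x.
move=> /nbhs_ballP[del /= del0 h]; exists (del / 2); first by rewrite divr_gt0.
move=> y xy; apply: h; rewrite -ball_normE/= distrC; apply: le_lt_trans xy _.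
by rewrite gtr_pMr// invf_lt1// ltr1n.
Qed.

Lemma continuous_cube2 n (f : 'rV[R]_n * 'rV[R]_n -> R) (x y : 'rV[R]_n) (e : R) :
  continuous f -> 0 < e ->
  exists2 del, 0 < del & forall x' y', cube x del x' -> cube y del y' ->
    `|f (x, y) - f (x', y')| <= e.
Proof.
move=> cf e0; have /cvgrPdist_le /(_ _ e0) := cf (x, y).
move=> /nbhs_ballP[del /= del0 h]; exists (del / 2); first by rewrite divr_gt0.
have d2 : del / 2 < del by rewrite gtr_pMr// invf_lt1// ltr1n.
move=> x' y' xx yy; apply: h; split; rewrite /= -ball_normE/= distrC.
  exact: le_lt_trans xx d2.
exact: le_lt_trans yy d2.
Qed.

Lemma cubeS n (x : 'rV[R]_n) (r s : R) : r <= s -> cube x r `<=` cube x s.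
Proof. by move=> rs y /le_trans; apply. Qed.

Lemma continuous_ge0_at0 (H : R -> R) (b : R) : 0 < b -> continuous H ->
  (forall s, 0 < s -> s < b -> 0 <= H s) -> 0 <= H 0.
Proof.
move=> b0 cH Hs; rewrite leNgt; apply/negP => H0.
have H0' : 0 < - H 0 by rewrite oppr_gt0.
have /cvgrPdist_lt /(_ _ H0') := cH 0.
move=> /nbhs_ballP[del /= del0 h].
pose s := Num.min (del / 2) (b / 2).
have s0 : 0 < s by rewrite lt_min !divr_gt0.
have sd : s < del.
  by rewrite gt_min gtr_pMr// invf_lt1// ltr1n.
have sb : s < b.
  by rewrite gt_min orbC gtr_pMr// invf_lt1// ltr1n.
have := h s; rewrite /ball/= sub0r normrN gtr0_norm// => /(_ sd).
have := Hs s s0 sb; rewrite ltr_norml => ? /andP[]; lra.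
Qed.

End small_cubes.

Section joint_density.
Context {R : realType} {n : nat} {d d' : measure_display}
  {Om : measurableType d} {Om' : measurableType d'}.
Variables (P : probability Om R) (W X : R -> Om -> 'rV[R]_n).
Variables (gamma : R -> R) (t : R).
Hypothesis gamma_cont : {within `[0, 1], continuous gamma}.
Hypothesis gamma_gt0 : forall s, 0 <= s <= 1 -> 0 < gamma s.
Hypothesis t01 : 0 < t <= 1.
Hypothesis X_sde : sde_solution P (fwd_drift gamma) (fwd_diffusion gamma) W X.
Variables (p : 'rV[R]_n -> R).
Hypothesis p_cont : continuous p.
Hypothesis X0_density : has_density P (lebesgue_rV R n) (X 0) p.
Variables (P' : probability Om' R) (U V : Om' -> 'rV[R]_n).
Hypothesis UV_law : forall A B, measurable A -> measurable B ->
  P' ((fun w => (U w, V w)) @^-1` (A `*` B)) = P (X 0 @^-1` A `&` X t @^-1` B).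
Variable j : 'rV[R]_n * 'rV[R]_n -> R.
Hypothesis UV_density : has_density P'
  (lebesgue_rV R n \x lebesgue_rV R n)%E (fun w => (U w, V w)) j.
Hypothesis j_cont : continuous j.

Let E := growth gamma t.
Let v := E ^+ 2 - 1.
Let noise w := E *: X t w - X 0 w.
Let limit_noise w := Num.sqrt v *: (W 1 w - W 0 w).

Let E0 : 0 < E. Proof. exact: growth_gt0. Qed.
Let v0 : 0 < v. Proof. exact: (growth_sqr_gt1 gamma_cont). Qed.

Lemma limit_noise_density :
  has_density P (lebesgue_rV R n) limit_noise (gaussian_pdf v).
Proof.
have [Ww _ _ _ _] := X_sde.
have h := wiener_increment_density Ww (lexx 0) ltr01 (lexx 1).
have sv0 : 0 < Num.sqrt v by rewrite sqrtr_gt0.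
have l10 : (0 : R) < 1 - 0 by rewrite subr0.
have := has_density_gaussian_scale sv0 l10 h.
by rewrite subr0 mulr1 sqr_sqrtr// ltW.
Qed.

(** Since noise - z = E (X_t - y) - (X_0 - x), once X_0 is within e r of x the event that X_t is
    within r of y lies between noise cubes about z of radii (E - e) r and (E + e) r. The squeeze
    costs another e r. Comparing probabilities of cubes and dividing by the volumes of the cubes
    about x and y gives both bounds. *)
Lemma joint_density_bounds (x y : 'rV[R]_n) (e : R) : 0 < e ->
  j (x, y) - e <=
    (p x + e) * (gaussian_pdf v (E *: y - x) + e) * (E + 2 * e) ^+ n /\
  (e < p x -> e < gaussian_pdf v (E *: y - x) -> 2 * e < E ->
   (p x - e) * (gaussian_pdf v (E *: y - x) - e) * (E - 2 * e) ^+ n <=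
   j (x, y) + e).
Proof.
move=> e0; set z := E *: y - x; set g := gaussian_pdf v.
have [_ [mX _] _ _ _] := X_sde; have [t0 t1] := andP t01.
have mX0 : measurable_fun setT (X 0) by apply: mX; rewrite lexx ler01.
have mXt : measurable_fun setT (X t) by apply: mX; rewrite ltW.
have [dj dj0 hj] := continuous_cube2 x y j_cont e0.
have [dp dp0 hp] := continuous_cube x p_cont e0.
have [dg dg0 hg] := continuous_cube z (continuous_gaussian_pdf v0) e0.
have Ee0 : 0 < E + 2 * e by rewrite addr_gt0// mulr_gt0.
(* Small enough for the continuity moduli on all cubes that occur: radii e * r and r for [j], e * r
   for [p], at most (E + 2 * e) * r for the Gaussian. *)
pose r := Num.min (Num.min dj (dj / e)) (Num.min (dp / e) (dg / (E + 2 * e))).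
have r0 : 0 < r by rewrite !lt_min dj0 !divr_gt0.
have [rj rje rp rg] : [/\ r <= dj, e * r <= dj, e * r <= dp & (E + 2 * e) * r <= dg].
  split; [| rewrite mulrC -ler_pdivlMr// | rewrite mulrC -ler_pdivlMr//
          | rewrite mulrC -ler_pdivlMr//];
  by rewrite /r !ge_min lexx ?orbT.
pose A := cube x (e * r); pose B := cube y r.
have er0 : 0 < e * r by rewrite mulr_gt0.
have mA : measurable A by exact: measurable_cube.
have mB : measurable B by exact: measurable_cube.
pose vA := ((e * r) *+ 2) ^+ n; pose vB := (r *+ 2) ^+ n.
have vA0 : 0 < vA by rewrite exprn_gt0// mulrn_wgt0.
have vB0 : 0 < vB by rewrite exprn_gt0// mulrn_wgt0.
have lA : lebesgue_rV R n A = vA%:E by apply: lebesgue_rV_cube; exact: ltW.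
have lB : lebesgue_rV R n B = vB%:E by apply: lebesgue_rV_cube; exact: ltW.
have lAB : (lebesgue_rV R n \x lebesgue_rV R n)%E (A `*` B) = (vA * vB)%:E.
  apply: (etrans (product_measure1E _ _ mA mB)); rewrite EFinM -lA -lB.
  by [].
have [mj j0 Pj] := UV_density.
have [mp p0 Pp] := X0_density.
have [mg g0 Pg] := limit_noise_density.
have Pjoint : P (X 0 @^-1` A `&` X t @^-1` B) =
    (\int[lebesgue_rV R n \x lebesgue_rV R n]_(u in A `*` B) (j u)%:E)%E.
  by rewrite -UV_law// Pj//; exact: measurableX.
have jA u : (A `*` B) u -> `|j (x, y) - j u| <= e.
  case: u => x' y' [/= xA yB]; apply: hj; first exact: cubeS xA.
  exact: cubeS yB.
have pA u : A u -> `|p x - p u| <= e by move=> uA; apply: hp; exact: cubeS uA.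
have vC s : 0 <= s -> lebesgue_rV R n (cube z (s * r)) = (s ^+ n * vB)%:E.
  move=> s0; rewrite lebesgue_rV_cube ?mulr_ge0 ?(ltW r0)//.
  by rewrite -mulrnAr exprMn.
have mcube (Z : Om -> 'rV[R]_n) c rho : measurable_fun setT Z ->
    measurable [set w | `|Z w - c| <= rho] by exact: measurable_preimage_cube.
have mN : measurable_fun setT noise.
  by apply: measurable_rVB => //; exact: measurable_rVZ.
have mXA : measurable (X 0 @^-1` A) by rewrite -[X in measurable X]setTI; exact: mX0.
have mXB : measurable (X t @^-1` B) by rewrite -[X in measurable X]setTI; exact: mXt.
split.
  have s1 : (((j (x, y) - e) * (vA * vB))%:E <= P (X 0 @^-1` A `&` X t @^-1` B))%E.
    rewrite Pjoint; apply: integral_ge_cst => //; first exact: measurableX.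
    by move=> u /jA; rewrite ler_distlC => /andP[].
  have s2 : (P (X 0 @^-1` A `&` X t @^-1` B) <=
      P (X 0 @^-1` A `&` [set w | (`|noise w - z| <= (E + e) * r)%R]))%E.
    apply: le_measure; rewrite ?inE.
    - exact: measurableI.
    - by apply: measurableI => //; exact: mcube.
    move=> w [/= Aw Bw]; split=> //.
    have -> : noise w - z = E *: (X t w - y) - (X 0 w - x).
      by apply/rowP => i; rewrite !mxE; ring.
    apply: le_trans (ler_normB _ _) _; rewrite mulrDl normrZ gtr0_norm//.
    by apply: lerD => //; rewrite ler_pM2l.
  (* The slack of the squeeze is e * r, which turns E + e into E + 2 * e. *)
  have s3 := le_noise_limit gamma_cont gamma_gt0 t01 X_sde z ((E + e) * r) mA er0.
  have s4 : (P (X 0 @^-1` A) <= ((p x + e) * vA)%:E)%E.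
    rewrite Pp//; apply: integral_le_cst => // u /pA.
    by rewrite ler_distlC => /andP[].
  have s5 : (P [set w | (`|limit_noise w - z| <= (E + e) * r + e * r)%R] <=
      ((g z + e) * ((E + 2 * e) ^+ n * vB))%:E)%E.
    rewrite -mulrDl -addrA -mulr2n -[e *+ 2]mulr_natl.
    rewrite (Pg (cube z ((E + 2 * e) * r)) (measurable_cube _ _)).
    apply: integral_le_cst => //; first exact: measurable_cube.
      by apply: vC; exact: ltW.
    move=> u uC; have : `|g z - g u| <= e by apply: hg; exact: cubeS uC.
    by rewrite ler_distlC => /andP[].
  have := le_trans s1 (le_trans s2 (le_trans s3 (lee_pmul _ _ s4 s5))).
  rewrite !measure_ge0 => /(_ isT isT); rewrite -EFinM lee_fin.
  rewrite (_ : _ * _ * (_ * _) =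
    (p x + e) * (g z + e) * (E + 2 * e) ^+ n * (vA * vB)); last by ring.
  by rewrite ler_pM2r// mulr_gt0.
(* The three side conditions keep all factors nonnegative, so that lower bounds may be
   multiplied. *)
move=> ep eg eE.
have Ee : 0 < E - 2 * e by rewrite subr_gt0.
have s1 : (P (X 0 @^-1` A `&` X t @^-1` B) <= ((j (x, y) + e) * (vA * vB))%:E)%E.
  rewrite Pjoint; apply: integral_le_cst => //; first exact: measurableX.
  by move=> u /jA; rewrite ler_distlC => /andP[].
have s2 : (P (X 0 @^-1` A `&` [set w | (`|noise w - z| <= (E - 2 * e) * r + e * r)%R])
    <= P (X 0 @^-1` A `&` X t @^-1` B))%E.
  apply: le_measure; rewrite ?inE.
  - by apply: measurableI => //; exact: mcube.
  - exact: measurableI.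
  move=> w [/= Aw Nw]; split=> //; rewrite /B /cube/=.
  rewrite -(ler_pM2l E0) -[X in X * `|_|]gtr0_norm// -normrZ.
  have -> : E *: (X t w - y) = (noise w - z) + (X 0 w - x).
    by apply/rowP => i; rewrite !mxE; ring.
  apply: le_trans (ler_normD _ _) _; apply: le_trans (lerD Nw Aw) _.
  by rewrite -!mulrDl; lra.
have s3 := le_limit_noise gamma_cont gamma_gt0 t01 X_sde z ((E - 2 * e) * r) mA er0.
have s4 : (((p x - e) * vA)%:E <= P (X 0 @^-1` A))%E.
  rewrite Pp//; apply: integral_ge_cst => // u /pA.
  by rewrite ler_distlC => /andP[].
have s5 : (((g z - e) * ((E - 2 * e) ^+ n * vB))%:E <=
    P [set w | (`|limit_noise w - z| <= (E - 2 * e) * r)%R])%E.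
  rewrite (Pg (cube z ((E - 2 * e) * r)) (measurable_cube _ _)).
  apply: integral_ge_cst => //; first exact: measurable_cube.
    by apply: vC; exact: ltW.
  move=> u uC; have : `|g z - g u| <= e.
    apply: hg; apply: cubeS uC; apply: le_trans rg.
    by rewrite ler_pM2r//; lra.
  by rewrite ler_distlC => /andP[].
have n1 : (0 <= ((p x - e) * vA)%:E)%E.
  by rewrite lee_fin mulr_ge0 ?subr_ge0 ?(ltW ep) ?(ltW vA0).
have n2 : (0 <= ((g z - e) * ((E - 2 * e) ^+ n * vB))%:E)%E.
  rewrite lee_fin; apply: mulr_ge0; first by rewrite subr_ge0; exact: ltW.
  by apply: mulr_ge0; [apply: exprn_ge0; exact: ltW|exact: ltW].
have := le_trans (lee_pmul n1 n2 s4 s5) (le_trans s3 (le_trans s2 s1)).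
rewrite -EFinM lee_fin.
rewrite (_ : _ * _ * (_ * _) =
  (p x - e) * (g z - e) * (E - 2 * e) ^+ n * (vA * vB)); last by ring.
by rewrite ler_pM2r// mulr_gt0.
Qed.

Lemma joint_densityE (x y : 'rV[R]_n) :
  j (x, y) = E ^+ n * (p x * gaussian_pdf v (E *: y - x)).
Proof.
set g := gaussian_pdf v (E *: y - x).
(* One function carries both bounds: for small s > 0 the upper one gives 0 <= H s and the lower one
   0 <= - H (- s). By continuity both signs hold at 0. *)
pose H s := (p x + s) * (g + s) * (E + 2 * s) ^+ n - j (x, y) + s.
have cH : continuous H.
  have cid : continuous (fun s : R => s) by move=> s; exact: cvg_id.
  have cc (k : R) : continuous (fun _ : R => k) by move=> s; exact: cvg_cst.
  move=> s; apply: cvgD; last exact: cid.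
  apply: cvgB; last exact: cc.
  apply: cvgM; first by apply: cvgM; apply: cvgD; [exact: cc|exact: cid|exact: cc|exact: cid].
  have h : (fun s : R => E + 2 * s) x @[x --> s] --> E + 2 * s.
    by apply: cvgD; [exact: cc|apply: cvgM; [exact: cc|exact: cid]].
  exact: (continuous_comp h (@exprn_continuous R n _)).
have H0 : H 0 = E ^+ n * (p x * g) - j (x, y).
  by rewrite /H !addr0 mulr0 addr0 [in RHS]mulrC.
have [_ p0 _] := X0_density; have [_ j0 _] := UV_density.
have g0 : 0 < g.
  rewrite /g gaussian_pdfE// mulr_gt0 ?expR_gt0// exprn_gt0//.
  by rewrite normal_peak_gt0// gt_eqF// sqrtr_gt0.
apply/eqP; rewrite eq_le; apply/andP; split.
  rewrite -subr_ge0 -H0; apply: (continuous_ge0_at0 ltr01 cH) => s s0 _.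
  have [h _] := joint_density_bounds x y s0.
  move: h; rewrite -/g /H; set Q := _ * _ ^+ _; lra.
(* Where p vanishes the lower bound has no admissible e, but there the right-hand side is 0 and [j]
   is nonnegative. *)
have [px0|px0] := leP (p x) 0.
  have -> : p x = 0 by apply/eqP; rewrite eq_le px0 p0.
  by rewrite mul0r mulr0.
pose b := Num.min (p x) (Num.min g (E / 2)).
have b0 : 0 < b by rewrite !lt_min px0 g0 divr_gt0.
rewrite -subr_ge0 -opprB -H0 -[0]oppr0.
have cH' : continuous (fun s => - H (- s)).
  move=> s; apply: cvgN.
  have ho : - s @[s --> s] --> - s by apply: cvgN; exact: cvg_id.
  exact: (continuous_comp ho (cH (- s))).
have := @continuous_ge0_at0 _ (fun s => - H (- s)) b b0 cH'.
rewrite oppr0; apply => s s0; rewrite !lt_min => /and3P[sp sg sE].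
have [_ h] := joint_density_bounds x y s0.
have sE2 : 2 * s < E by move: sE; rewrite ltr_pdivlMr// mulrC.
have := h sp sg sE2; rewrite -/g /H mulrN; set Q := _ * _ ^+ _; lra.
Qed.

End joint_density.

(** * Half-spaces and the posterior density *)

Section robustness.
Context {R : realType} {n : nat} (gamma : R -> R) (t : R).
Context {L : finType} (f : 'rV[R]_n -> L) (p : 'rV[R]_n -> R).
Hypothesis sigma2_gt0 : 0 < sigma2 gamma t.
Hypothesis p_ge0 : forall x, 0 <= p x.
Implicit Types x y xa : 'rV[R]_n.

(* The posterior density of the clean sample [x] given the noisy observation of
   [xa], up to a factor independent of [x]. *)
Definition posterior xa x : R :=
  p x * expR (- (sqnorm (xa - x) / (sigma2 gamma t *+ 2))).

Lemma sqnormB_dot xa x y :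
  sqnorm (xa - y) - sqnorm (xa - x) = dot (xa - y) (x - y) *+ 2 - sqnorm (x - y).
Proof.
rewrite /sqnorm /dot -sumrMnl -!sumrB; apply: eq_bigr => i _.
by rewrite !mxE; ring.
Qed.

(** Take logarithms of the posteriors: the term quadratic in [xa] is common to both sides and
    cancels, which leaves a condition affine in [xa]. *)
Lemma halfspace_posterior xa x y :
  ((dot (xa - y) (x - y))%:E <
    (sigma2 gamma t)%:E * log_ratio (p y) (p x) + (sqnorm (x - y) / 2)%:E)%E
  = (posterior xa x < posterior xa y).
Proof.
(* If p y = 0 the bound is -oo, and the posterior at y is 0, which nothing nonnegative is below. *)
rewrite /log_ratio /posterior; case: eqVneq => [->|py0].
  rewrite gt0_muleNy ?lte_fin// mul0r [RHS]ltNge mulr_ge0 ?expR_ge0//.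
have py : 0 < p y by rewrite lt_neqAle eq_sym py0 p_ge0.
(* If only p x = 0 the bound is +oo, and the posterior is 0 at x and positive at y. *)
case: eqVneq => [->|px0].
  by rewrite gt0_muley ?lte_fin// mul0r mulr_gt0 ?expR_gt0// addye// ltry.
have px : 0 < p x by rewrite lt_neqAle eq_sym px0 p_ge0.
rewrite -EFinM -EFinD lte_fin -[RHS]ltr_ln ?posrE ?mulr_gt0 ?expR_gt0//.
rewrite ln_div ?posrE// !lnM ?posrE ?expR_gt0// !expRK.
have sg := sigma2_gt0.
have := sqnormB_dot xa x y; set a := sqnorm (xa - y); set b := sqnorm (xa - x).
set D := dot _ _; set c := sqnorm (x - y); set v := sigma2 _ _ in sg *.
move=> abE; have v2 : 0 < v *+ 2 by rewrite mulrn_wgt0.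
rewrite -[LHS]subr_gt0 -[RHS]subr_gt0.
set lx := ln (p x); set ly := ln (p y).
have -> : v * (ly - lx) + c / 2 - D = (v * (ly - lx) *+ 2 - (D *+ 2 - c)) / 2.
  by field.
have -> : ly - a / (v *+ 2) - (lx - b / (v *+ 2)) =
    (v * (ly - lx) *+ 2 - (a - b)) / (v *+ 2).
  by field; rewrite gt_eqF.
by rewrite abE !pmulr_lgt0 ?invr_gt0.
Qed.

Lemma D_subP xa y : D_sub gamma f p t y xa <->
  forall x, f x <> f y -> posterior xa x < posterior xa y.
Proof.
split=> [h x fx|h x /= fx]; last by rewrite halfspace_posterior h.
by have := h x fx; rewrite /= halfspace_posterior.
Qed.

Lemma convex_D_sub y : @convex_set R 'rV[R]_n (D_sub gamma f p t y).
Proof.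
move=> a b l; rewrite !inE => ha hb x fx; have := ha x fx; have := hb x fx.
rewrite /=; set C := (_ + _)%E => hb' ha'.
have cE : conv l a b = l%:inum *: (a : 'rV[R]_n) + (1 - l%:inum) *: (b : 'rV[R]_n) by [].
rewrite cE; have -> : dot (l%:inum *: (a : 'rV[R]_n) +
      (1 - l%:inum) *: (b : 'rV[R]_n) - y) (x - y) =
    l%:inum * dot (a - y) (x - y) + (1 - l%:inum) * dot (b - y) (x - y).
  rewrite /dot !mulr_sumr -big_split/=; apply: eq_bigr => i _.
  by rewrite !mxE; ring.
(* The bound [C] may be infinite, so the convex combination is compared with the larger of the two
   real values instead of combining the two inequalities. *)
apply: (@le_lt_trans _ _
    (Num.max (dot (a - y) (x - y)) (dot (b - y) (x - y)))%:E); last first.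
  by case: (leP (dot (a - y) (x - y)) (dot (b - y) (x - y))).
rewrite lee_fin; set A := dot _ _; set B := dot _ _.
have l0 : 0 <= l%:inum :> R by [].
have l1 : l%:inum <= 1 :> R by [].
have -> : Num.max A B = l%:inum * Num.max A B + (1 - l%:inum) * Num.max A B by ring.
by apply: lerD; apply: ler_wpM2l; rewrite ?subr_ge0// le_max lexx ?orbT.
Qed.

Variable Pur : 'rV[R]_n -> 'rV[R]_n.
Hypothesis Pur_argmax : forall xa, unique_argmax (posterior xa) (Pur xa).

Lemma label_D_sub xa y : D_sub gamma f p t y xa -> f (Pur xa) = f y.
Proof.
move=> /D_subP h; apply: contrapT => /h; rewrite ltNge.
by have [-> _] := Pur_argmax xa.
Qed.

(** Uniqueness of the maximizer provides the strict inequality: a point with another label and the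
    same posterior would be a second maximizer. *)
Lemma D_sub_Pur xa : D_sub gamma f p t (Pur xa) xa.
Proof.
apply/D_subP => x fx; have [hmax huniq] := Pur_argmax xa.
rewrite lt_neqAle hmax andbT; apply: contra_notN fx => /eqP px.
by congr f; apply: huniq => z; rewrite px.
Qed.

Lemma D_regionP x0 xa : f (Pur xa) = f x0 <-> D_region gamma f p t x0 xa.
Proof.
split=> [fx|[y fy /label_D_sub ->//]].
by exists (Pur xa) => //; exact: D_sub_Pur.
Qed.

End robustness.

(** * From the reverse process to the posterior maximizer *)

Section diffusion_coefficients.
Context {R : realType} (gamma : R -> R) (t : R).

Lemma alphaE : alpha gamma t = (growth gamma t ^+ 2)^-1.
Proof.
rewrite /growth expr2 -expRD -expRN; congr expR.
by rewrite /cumul; field.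
Qed.

Lemma sqrt_alphaE : Num.sqrt (alpha gamma t) = (growth gamma t)^-1.
Proof. by rewrite alphaE -exprVn sqrtr_sqr gtr0_norm// invr_gt0 growth_gt0. Qed.

Lemma sigma2E : sigma2 gamma t = growth gamma t ^+ 2 - 1.
Proof.
rewrite /sigma2 alphaE invrK mulrBl mul1r mulVf//.
by rewrite expf_eq0/= gt_eqF// growth_gt0.
Qed.

End diffusion_coefficients.

Section purification_argmax.
Context {R : realType} {n : nat} {d d' : measure_display}
  {Om : measurableType d} {Om' : measurableType d'}.
Variables (P : probability Om R) (W X : R -> Om -> 'rV[R]_n).
Variables (gamma : R -> R) (t : R) (p : 'rV[R]_n -> R).
Variables (P' : probability Om' R) (X' : R -> Om' -> 'rV[R]_n).
Hypothesis gamma_cont : {within `[0, 1], continuous gamma}.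
Hypothesis gamma_gt0 : forall s, 0 <= s <= 1 -> 0 < gamma s.
Hypothesis t01 : 0 < t <= 1.
Hypothesis X_sde : sde_solution P (fwd_drift gamma) (fwd_diffusion gamma) W X.
Hypothesis p_cont : continuous p.
Hypothesis X0_density : has_density P (lebesgue_rV R n) (X 0) p.
Hypothesis X'_law : same_distribution P P' X X'.

Lemma same_distribution_pair (A B : set 'rV[R]_n) :
  measurable A -> measurable B ->
  P' ((fun w => (X' 0 w, X' t w)) @^-1` (A `*` B)) =
  P (X 0 @^-1` A `&` X t @^-1` B).
Proof.
move=> mA mB; have [t0 t1] := andP t01.
pose s (k : 'I_2) := if k == 0 then 0 else t.
pose C (k : 'I_2) := if k == 0 then A else B.
have E d0 (O : measurableType d0) (Y : R -> O -> 'rV[R]_n) :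
    [set w | forall k, C k (Y (s k) w)] = Y 0 @^-1` A `&` Y t @^-1` B.
  apply/seteqP; split=> w /=.
    by move=> h; split; [exact: (h 0)|exact: (h 1)].
  by move=> [hA hB] k; rewrite /C /s; case: ifP.
have := X'_law (s := s) (A := C); rewrite !E => -> //.
- by move=> k; rewrite /s; case: ifP => _; rewrite ?lexx ?ler01// ltW.
- by move=> k; rewrite /C; case: ifP.
Qed.

(** At y = sqrt(alpha_t) xa one has E y = xa, so the conditional density is the posterior times a
    factor independent of x. It remains to see that this factor is positive. *)
Lemma purification_posterior (Pur : 'rV[R]_n -> 'rV[R]_n) :
  purification gamma P' X' t Pur ->
  forall xa, unique_argmax (posterior gamma t p xa) (Pur xa).
Proof.
move=> [c [[j [q [[jd jc] [qd qc] cE]]] cmax]] xa.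
have [hmax huniq] := cmax xa.
pose E := growth gamma t; have E0 : 0 < E := growth_gt0 gamma t.
have v0 := growth_sqr_gt1 gamma_cont gamma_gt0 t01.
set y := Num.sqrt (alpha gamma t) *: xa in hmax huniq.
have Ey : E *: y = xa.
  by rewrite /y sqrt_alphaE scalerA divff ?scale1r// gt_eqF.
have jE x : j (x, y) =
    E ^+ n * normal_peak (Num.sqrt (E ^+ 2 - 1)) ^+ n * posterior gamma t p xa x.
  rewrite (joint_densityE gamma_cont gamma_gt0 t01 X_sde p_cont X0_density
    same_distribution_pair jd jc) -/E Ey gaussian_pdfE// /posterior sigma2E.
  by rewrite -/E; ring.
have cE' x : c x y = E ^+ n * normal_peak (Num.sqrt (E ^+ 2 - 1)) ^+ n / q y *
    posterior gamma t p xa x.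
  by rewrite cE jE mulrAC.
have [n0|n0] := posnP n.
  have all_eq (u u' : 'rV[R]_n) : u = u'.
    by apply/rowP => i; have := ltn_ord i; rewrite {2}n0.
  by split=> [u|u _]; [rewrite (all_eq u (Pur xa))|exact: all_eq].
(* Otherwise division by 0 makes the conditional density vanish identically, and every point would
   be a maximizer, against uniqueness. *)
have qy0 : q y != 0.
  apply/eqP => qy0.
  have c0 u : c u y = 0 by rewrite cE qy0 invr0 mulr0.
  have eqPur u : u = Pur xa by apply: huniq => z; rewrite !c0.
  have /rowP/(_ (Ordinal n0)) : const_mx 1 = 0 :> 'rV[R]_n.
    by rewrite (eqPur (const_mx 1)) -(eqPur 0).
  by rewrite !mxE => /eqP; rewrite oner_eq0.
have [_ q0 _] := qd.
have K0 : 0 < E ^+ n * normal_peak (Num.sqrt (E ^+ 2 - 1)) ^+ n / q y.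
  rewrite divr_gt0//; last by rewrite lt_neqAle eq_sym qy0 q0.
  rewrite mulr_gt0 ?exprn_gt0// normal_peak_gt0//.
  by rewrite gt_eqF// sqrtr_gt0.
split=> [u|u hu]; first by rewrite -(ler_pM2l K0) -!cE'.
by apply: huniq => z; rewrite !cE' ler_pM2l.
Qed.

End purification_argmax.

Theorem theorem3p3 (R : realType) (n : nat)
  (p : 'rV[R]_n -> R) (gamma : R -> R) (t : R)
  (L : finType) (f : 'rV[R]_n -> L) (x0 xa : 'rV[R]_n)
  (Pur : 'rV[R]_n -> 'rV[R]_n)
  (d : measure_display) (Om : measurableType d) (P : probability Om R)
  (x w : R -> Om -> 'rV[R]_n)
  (d' : measure_display) (Om' : measurableType d') (P' : probability Om' R)
  (xhat wbar : R -> Om' -> 'rV[R]_n)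
  (pt : R -> 'rV[R]_n -> R)
  (p_C2 : C2 p)
  (p_moment : (\int[lebesgue_rV R n]_z (sqnorm z * p z)%:E < +oo)%E)
  (gamma_cont : {within `[0, 1], continuous gamma})
  (gamma_gt0 : forall s, 0 <= s <= 1 -> 0 < gamma s)
  (t01 : 0 < t <= 1)
  (x_init : has_density P (lebesgue_rV R n) (x 0) p)
  (x_sde : sde_solution P (fwd_drift gamma) (fwd_diffusion gamma) w x)
  (x_density : forall s, 0 <= s <= 1 ->
     has_density P (lebesgue_rV R n) (x s) (pt s) /\ continuous (pt s))
  (xhat_sde : reverse_sde_solution P' (rev_drift gamma pt)
     (fwd_diffusion gamma) wbar xhat)
  (xhat_dist : same_distribution P P' x xhat)
  (Pur_model : purification gamma P' xhat t Pur) :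
  [/\ @convex_set R 'rV[R]_n (D_sub gamma f p t x0),
      D_sub gamma f p t x0 xa -> f (Pur xa) = f x0,
      f (Pur xa) = f x0 <-> D_region gamma f p t x0 xa &
      D_region gamma f p t x0 = robust_region f Pur x0].
Proof.
have p_cont : continuous p by have [[]] := p_C2.
have [_ p_ge0 _] := x_init.
have s2 : 0 < sigma2 gamma t.
  by rewrite sigma2E; exact: (growth_sqr_gt1 gamma_cont).
have Pur_max := purification_posterior gamma_cont gamma_gt0 t01 x_sde p_cont
  x_init xhat_dist Pur_model.
split.
- exact: convex_D_sub.
- exact: (label_D_sub s2 p_ge0 Pur_max).
- exact: (D_regionP f s2 p_ge0 Pur_max x0 xa).
- by apply/seteqP; split=> z /(D_regionP f s2 p_ge0 Pur_max x0 z).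
Qed.
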